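(* Let $i\in\mathbb{N}_0$ and let $\alpha,\beta,\gamma\in\mathbb{C}$. Then $$F^{2:0;1}_{1:0;1}\left[\begin{matrix}\alpha,\ \gamma: & -\,; & 1-\alpha-\beta+\gamma+i\,;\\ \beta: & -\,; & 1-\alpha+\gamma+i\,;\end{matrix}\ -1,\ 1\right] =\frac{2^{i-2\alpha}\,\Gamma(\alpha-i)\,\Gamma(1-\alpha+\gamma+i)}{\Gamma(\alpha)\,\Gamma(1+\gamma-2\alpha+i)}\sum_{r=0}^{i}(-1)^r\binom{i}{r}\frac{\Gamma\!\left(\frac{1+\gamma+i+r}{2}-\alpha\right)}{\Gamma\!\left(\frac{1+\gamma-i+r}{2}\right)}$$ and $$F^{2:0;1}_{1:0;1}\left[\begin{matrix}\alpha,\ \gamma: & -\,; & 1-\alpha-\beta+\gamma-i\,;\\ \beta: & -\,; & 1-\alpha+\gamma-i\,;\end{matrix}\ -1,\ 1\right] =\frac{2^{-i-2\alpha}\,\Gamma(1-\alpha+\gamma-i)}{\Gamma(1+\gamma-2\alpha-i)}\sum_{r=0}^{i}\binom{i}{r}\frac{\Gamma\!\left(\frac{1+\gamma-i+r}{2}-\alpha\right)}{\Gamma\!\left(\frac{1+\gamma-i+r}{2}\right)}.$$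
   Context: For $\lambda\in\mathbb{C}$ and $n\in\mathbb{N}_0$, $(\lambda)_0=1$ and $(\lambda)_n=\lambda(\lambda+1)\cdots(\lambda+n-1)$; $\Gamma$ is Euler's Gamma function and $\binom{i}{r}$ the binomial coefficient. The (generalized) Kampé de Fériet function is defined by $$F^{H:A;B}_{G:C;D}\left[\begin{matrix}(h_H): & (a_A)\,; & (b_B)\,;\\ (g_G): & (c_C)\,; & (d_D)\,;\end{matrix}\ x,\ y\right]=\sum_{m=0}^\infty\sum_{n=0}^\infty\frac{\prod_{j=1}^H(h_j)_{m+n}\prod_{j=1}^A(a_j)_m\prod_{j=1}^B(b_j)_n}{\prod_{j=1}^G(g_j)_{m+n}\prod_{j=1}^C(c_j)_m\prod_{j=1}^D(d_j)_n}\frac{x^m}{m!}\frac{y^n}{n!},$$ where a dash ''$-$'' denotes an empty list of parameters (empty products equal $1$). Parameters are tacitly assumed to be such that the double series converges, no denominator parameter is a non-positive integer, and all Gamma values appearing are finite. *)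

(* Defs.v *)
From Stdlib Require Import Reals List Arith Factorial.
From Coquelicot Require Import Coquelicot.
Open Scope C_scope.

Definition Cexp (z : C) : C :=
  (exp (Re z) * cos (Im z), exp (Re z) * sin (Im z))%R.

Definition Cpowr (a : R) (z : C) : C := Cexp (RtoC (ln a) * z).

Fixpoint poch (a : C) (n : nat) : C :=
  match n with
  | O => 1
  | S k => poch a k * (a + RtoC (INR k))
  end.

Definition nonpos_int (z : C) : Prop := exists k : nat, z = RtoC (- INR k).

(* Euler's Gamma function via Gauss' limit formula
     Gamma z = lim_{n -> oo} n^z n! / (z (z+1) ... (z+n)),
   valid (and the limit exists) for every z not a non-positive integer;
   the value at the poles is irrelevant (junk). *)
Definition gauss_seq (z : C) (n : nat) : C :=
  Cpowr (INR n) z * RtoC (INR (fact n)) / poch z (S n).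

Definition CGamma (z : C) : C :=
  (real (Lim_seq (fun n => Re (gauss_seq z n))),
   real (Lim_seq (fun n => Im (gauss_seq z n)))).

Definition poch_prod (l : list C) (n : nat) : C :=
  fold_right (fun a acc => poch a n * acc) 1 l.

(* general term of the Kampe de Feriet series
   F^{H:A;B}_{G:C;D}[(h):(a);(b);(g):(c);(d); x, y] *)
Definition kdf_term (h a b g c d : list C) (x y : C) (m n : nat) : C :=
  poch_prod h (m + n) * poch_prod a m * poch_prod b n
  / (poch_prod g (m + n) * poch_prod c m * poch_prod d n)
  * (x ^ m / RtoC (INR (fact m))) * (y ^ n / RtoC (INR (fact n))).

(* partial sums of the double series, grouped by total degree m + n
   (i.e. as the power series in t of F(tx, ty), evaluated at t = 1):
     sum_{k=0}^{N} sum_{m+n=k} term m n *)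
Definition kdf_partial (h a b g c d : list C) (x y : C) (N : nat) : C :=
  sum_n (fun k => sum_n (fun m => kdf_term h a b g c d x y m (k - m)) k) N.

Definition kdf_sum (h a b g c d : list C) (x y L : C) : Prop :=
  filterlim (kdf_partial h a b g c d x y) eventually (locally L).

(* Main.v *)
(* Grouping by total degree, the Chu-Vandermonde identity collapses the double series to
   2F1(alpha, gamma; d; -1) with d = 1 - alpha + gamma +- i.  Abel's theorem and Pfaff's
   transformation turn it into 2^(-alpha) 2F1(alpha, d - gamma; d; 1/2); Pfaff's transformation on
   the whole of (-1, 0] is a Taylor expansion in y = x / (x - 1), all of whose derivatives are again
   Gauss series, so that the remainder is explicit.  As d - gamma = 1 - alpha +- i, contiguity
   relations at 1/2 reduce the value, by a binomial expansion, to the case i = 0 (Bailey's theorem).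
   For i = 0 a telescoping sum gives a first-order recurrence d -> d + 2, solved by letting
   d tend to infinity, where Gauss' limit formula supplies the asymptotics of Gamma. *)

Require Import Defs.
From Stdlib Require Import Reals List ZArith Factorial Lra Lia.
From Coquelicot Require Import Coquelicot.
Import ListNotations.
Open Scope C_scope.


(** [kdf_sum] only asserts convergence of the partial sums by total degree, so the series at -1 may
    converge only conditionally; every other series in use converges absolutely, and -1 is reached
    as a limit from the interior. The contiguity relations move d through values that can be poles
    of Gamma even for admissible parameters. Hence the entire function 1 / Gamma ([rGamma]) carries
    the argument; it is the limit of the inverted Gauss sequence at every point. Bailey's value is
    Gamma(d/2) Gamma((d+1)/2) / (Gamma((d+a)/2) Gamma((d-a+1)/2)). By duplication it equals 2^(-a)
    Gamma(d) Gamma((d-a)/2) / (Gamma(d-a) Gamma((d+a)/2)). Proving the latter form directly involves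
    neither pi nor the duplication formula, and it has the shape of the summands of the theorem. The
    two identities differ in direction: the parameters alpha, 1 - alpha + i arise from a = alpha - i
    by raising a, which produces the signs and Gamma(alpha - i) / Gamma(alpha); alpha, 1 - alpha - i
    arise by lowering the second parameter, which produces neither. *)

Lemma C_ext (z w : C) : Re z = Re w -> Im z = Im w -> z = w.
Proof. destruct z, w; simpl; intros; subst; reflexivity. Qed.

Lemma im_le_Cmod (z : C) : (Rabs (Im z) <= Cmod z)%R.
Proof.
  eapply Rle_trans; [ apply Rmax_r | apply (Rmax_Cmod z) ].
Qed.

Lemma Cmod_le_re_im (z : C) : (Cmod z <= Rabs (Re z) + Rabs (Im z))%R.
Proof.
  replace z with (RtoC (Re z) + RtoC (Im z) * Ci) at 1
    by (apply C_ext; simpl; ring).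
  eapply Rle_trans; [ apply Cmod_triangle | ].
  rewrite Cmod_mult, Cmod_Ci, !Cmod_R, Rmult_1_r; apply Rle_refl.
Qed.

(** * Limits of complex sequences *)

(** Componentwise, because [CGamma] is itself built from real limits of the two components. *)
Definition Clim (u : nat -> C) (l : C) : Prop :=
  is_lim_seq (fun n => Re (u n)) (Re l) /\ is_lim_seq (fun n => Im (u n)) (Im l).

Lemma Clim_unique (u : nat -> C) (l l' : C) : Clim u l -> Clim u l' -> l = l'.
Proof.
  intros [H1 H2] [H3 H4].
  apply is_lim_seq_unique in H1, H2, H3, H4.
  rewrite H1 in H3; rewrite H2 in H4; injection H3; injection H4.
  intros; apply C_ext; auto.
Qed.

Lemma Clim_ext_loc (u v : nat -> C) (l : C) :
  eventually (fun n => u n = v n) -> Clim u l -> Clim v l.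
Proof.
  intros H [H1 H2]; split; (eapply is_lim_seq_ext_loc; [ | eassumption ]);
    destruct H as [N H]; exists N; intros n Hn; rewrite (H n Hn); reflexivity.
Qed.

Lemma Clim_ext (u v : nat -> C) (l : C) :
  (forall n, u n = v n) -> Clim u l -> Clim v l.
Proof. intros H; apply Clim_ext_loc; exists O; intros n _; apply H. Qed.

Lemma Clim_const (l : C) : Clim (fun _ => l) l.
Proof. split; apply is_lim_seq_const. Qed.

Lemma Clim_plus (u v : nat -> C) (l l' : C) :
  Clim u l -> Clim v l' -> Clim (fun n => u n + v n) (l + l').
Proof. intros [H1 H2] [H3 H4]; split; apply is_lim_seq_plus'; assumption. Qed.

Lemma Clim_mult (u v : nat -> C) (l l' : C) :
  Clim u l -> Clim v l' -> Clim (fun n => u n * v n) (l * l').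
Proof.
  intros [H1 H2] [H3 H4]; split; simpl.
  - apply is_lim_seq_minus'; apply is_lim_seq_mult'; assumption.
  - apply is_lim_seq_plus'; apply is_lim_seq_mult'; assumption.
Qed.

Lemma Clim_minus (u v : nat -> C) (l l' : C) :
  Clim u l -> Clim v l' -> Clim (fun n => u n - v n) (l - l').
Proof.
  intros H1 H2; apply Clim_ext with (u := fun n => u n + (-1) * v n).
  { intro n; ring. }
  replace (l - l') with (l + (-1) * l') by ring.
  apply Clim_plus; [ assumption | apply Clim_mult; [ apply Clim_const | assumption ] ].
Qed.

Lemma C_neq0_re_im (l : C) : l <> 0 -> (Re l ^ 2 + Im l ^ 2 <> 0)%R.
Proof.
  intros Hl H; apply Hl; apply C_ext; simpl; nra.
Qed.

Lemma Clim_inv (u : nat -> C) (l : C) :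
  l <> 0 -> Clim u l -> Clim (fun n => / u n) (/ l).
Proof.
  intros Hl [H1 H2]; pose proof (C_neq0_re_im l Hl) as Hn.
  assert (Hd : is_lim_seq (fun n => Re (u n) ^ 2 + Im (u n) ^ 2)%R
                          (Re l ^ 2 + Im l ^ 2)%R).
  { apply is_lim_seq_plus'; simpl.
    - apply is_lim_seq_mult'; [ assumption | ].
      apply is_lim_seq_mult'; [ assumption | apply is_lim_seq_const ].
    - apply is_lim_seq_mult'; [ assumption | ].
      apply is_lim_seq_mult'; [ assumption | apply is_lim_seq_const ]. }
  split; simpl.
  - apply is_lim_seq_div'; assumption.
  - apply (is_lim_seq_div' (fun n => - Im (u n))%R); try assumption.
    apply (is_lim_seq_opp _ (Im l)); assumption.
Qed.

Lemma Clim_Cmod_0 (u : nat -> C) (l : C) :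
  is_lim_seq (fun n => Cmod (u n - l)) 0 -> Clim u l.
Proof.
  intro H.
  assert (G : forall f : C -> R, (forall z w : C, f (z - w)%C = (f z - f w)%R) ->
    (forall z, Rabs (f z) <= Cmod z)%R -> is_lim_seq (fun n => f (u n)) (f l)).
  { intros f Hf Hb.
    replace (f l) with (0 + f l)%R by ring.
    apply is_lim_seq_ext with (u := fun n => (f (u n - l)%C + f l)%R).
    { intro n; rewrite Hf; ring. }
    apply is_lim_seq_plus'; [ | apply is_lim_seq_const ].
    apply (is_lim_seq_abs_0 (fun n => f (u n - l))).
    apply is_lim_seq_le_le with (u := fun _ => 0%R) (w := fun n => Cmod (u n - l)).
    - intro n; split; [ apply Rabs_pos | apply Hb ].
    - apply is_lim_seq_const.
    - assumption. }
  split; [ apply (G Re) | apply (G Im) ];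
    try reflexivity; try apply re_le_Cmod; apply im_le_Cmod.
Qed.

Lemma Clim_le_0 (u : nat -> C) (v : nat -> R) (l : C) :
  (forall n, Cmod (u n - l) <= v n)%R -> is_lim_seq v 0 -> Clim u l.
Proof.
  intros H Hv; apply Clim_Cmod_0.
  apply is_lim_seq_le_le with (u := fun _ => 0%R) (w := v); try assumption.
  - intro n; split; [ apply Cmod_ge_0 | apply H ].
  - apply is_lim_seq_const.
Qed.

Lemma Clim_subseq (u : nat -> C) (l : C) (phi : nat -> nat) :
  filterlim phi eventually eventually -> Clim u l -> Clim (fun n => u (phi n)) l.
Proof.
  intros Hp [H1 H2]; split.
  - apply (is_lim_seq_subseq (fun n => Re (u n))); assumption.
  - apply (is_lim_seq_subseq (fun n => Im (u n))); assumption.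
Qed.

Lemma Clim_incr_1 (u : nat -> C) (l : C) : Clim u l -> Clim (fun n => u (S n)) l.
Proof. apply Clim_subseq; apply eventually_subseq; intro n; lia. Qed.

Lemma filterlim_Clim (u : nat -> C) (l : C) :
  filterlim u eventually (locally l) -> Clim u l.
Proof.
  intro H; split; intros P HP.
  - assert (G : locally l (fun z : C => P (Re z))).
    { destruct HP as [e HP]; exists e; intros z [Hz _]; apply HP; exact Hz. }
    exact (H _ G).
  - assert (G : locally l (fun z : C => P (Im z))).
    { destruct HP as [e HP]; exists e; intros z [_ Hz]; apply HP; exact Hz. }
    exact (H _ G).
Qed.

(** * Absolutely convergent complex series *)

(** A total function with arbitrary value on divergent series; summability is carried separately by
    [Cabs]. *)
Definition Cser (a : nat -> C) : C :=
  (Series (fun n => Re (a n)), Series (fun n => Im (a n))).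

Definition Cabs (a : nat -> C) : Prop := ex_series (fun n => Cmod (a n)).

Lemma Re_sum_n (a : nat -> C) (n : nat) : Re (sum_n a n) = sum_n (fun k => Re (a k)) n.
Proof.
  induction n; [ rewrite !sum_O; reflexivity | ].
  rewrite !sum_Sn, <- IHn; reflexivity.
Qed.

Lemma Im_sum_n (a : nat -> C) (n : nat) : Im (sum_n a n) = sum_n (fun k => Im (a k)) n.
Proof.
  induction n; [ rewrite !sum_O; reflexivity | ].
  rewrite !sum_Sn, <- IHn; reflexivity.
Qed.

Lemma Cabs_abs_Re (a : nat -> C) : Cabs a -> ex_series (fun n => Rabs (Re (a n))).
Proof.
  intro H; apply (ex_series_le (K := R_AbsRing) (V := R_CompleteNormedModule)) with (2 := H).
  intro n; unfold norm; simpl; unfold abs; simpl.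
  rewrite Rabs_Rabsolu; apply re_le_Cmod.
Qed.

Lemma Cabs_abs_Im (a : nat -> C) : Cabs a -> ex_series (fun n => Rabs (Im (a n))).
Proof.
  intro H; apply (ex_series_le (K := R_AbsRing) (V := R_CompleteNormedModule)) with (2 := H).
  intro n; unfold norm; simpl; unfold abs; simpl.
  rewrite Rabs_Rabsolu; apply im_le_Cmod.
Qed.

Lemma Cabs_Re (a : nat -> C) : Cabs a -> ex_series (fun n => Re (a n)).
Proof. intro H; apply ex_series_Rabs, Cabs_abs_Re, H. Qed.

Lemma Cabs_Im (a : nat -> C) : Cabs a -> ex_series (fun n => Im (a n)).
Proof. intro H; apply ex_series_Rabs, Cabs_abs_Im, H. Qed.

Lemma Cabs_le (a : nat -> C) (b : nat -> R) :
  (forall n, Cmod (a n) <= b n)%R -> ex_series b -> Cabs a.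
Proof.
  intros H Hb; unfold Cabs.
  apply (ex_series_le (K := R_AbsRing) (V := R_CompleteNormedModule)) with (2 := Hb).
  intro n; unfold norm; simpl; unfold abs; simpl.
  rewrite Rabs_pos_eq; [ apply H | apply Cmod_ge_0 ].
Qed.

Lemma Cser_lim (a : nat -> C) : Cabs a -> Clim (sum_n a) (Cser a).
Proof.
  intro H; split; simpl.
  - apply is_lim_seq_ext with (u := sum_n (fun k => Re (a k))).
    { intro n; symmetry; apply Re_sum_n. }
    apply (Series_correct (fun k => Re (a k))), Cabs_Re, H.
  - apply is_lim_seq_ext with (u := sum_n (fun k => Im (a k))).
    { intro n; symmetry; apply Im_sum_n. }
    apply (Series_correct (fun k => Im (a k))), Cabs_Im, H.
Qed.

Lemma Cser_ext (a b : nat -> C) : (forall n, a n = b n) -> Cser a = Cser b.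
Proof.
  intro H; unfold Cser; f_equal; apply Series_ext; intro n; rewrite H; reflexivity.
Qed.

Lemma Cabs_plus (a b : nat -> C) : Cabs a -> Cabs b -> Cabs (fun n => a n + b n).
Proof.
  intros Ha Hb; apply Cabs_le with (b := fun n => (Cmod (a n) + Cmod (b n))%R).
  - intro n; apply Cmod_triangle.
  - apply (ex_series_plus (V := R_NormedModule) _ _ Ha Hb).
Qed.

Lemma Cabs_scal (c : C) (a : nat -> C) : Cabs a -> Cabs (fun n => c * a n).
Proof.
  intros Ha; apply Cabs_le with (b := fun n => (Cmod c * Cmod (a n))%R).
  - intro n; rewrite Cmod_mult; apply Rle_refl.
  - apply (ex_series_scal_l (V := R_NormedModule) (Cmod c) _ Ha).
Qed.

Lemma Cser_plus (a b : nat -> C) :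
  Cabs a -> Cabs b -> Cser (fun n => a n + b n) = Cser a + Cser b.
Proof.
  intros Ha Hb; apply C_ext; simpl; apply Series_plus;
    auto using Cabs_Re, Cabs_Im.
Qed.

Lemma Cser_scal (c : C) (a : nat -> C) :
  Cabs a -> Cser (fun n => c * a n) = c * Cser a.
Proof.
  intros Ha.
  pose proof (Cabs_Re a Ha); pose proof (Cabs_Im a Ha).
  apply C_ext; simpl.
  - rewrite Series_minus by (apply (ex_series_scal_l (V := R_NormedModule)); assumption).
    rewrite !Series_scal_l; reflexivity.
  - rewrite Series_plus by (apply (ex_series_scal_l (V := R_NormedModule)); assumption).
    rewrite !Series_scal_l; reflexivity.
Qed.

Lemma Cmod_Cser_le (a : nat -> C) (b : nat -> R) :
  (forall n, Cmod (a n) <= b n)%R -> ex_series b -> (Cmod (Cser a) <= 2 * Series b)%R.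
Proof.
  intros H Hb; pose proof (Cabs_le a b H Hb) as Ha.
  eapply Rle_trans; [ apply Cmod_le_re_im | simpl ].
  pose proof (Series_Rabs _ (Cabs_abs_Re a Ha)).
  pose proof (Series_Rabs _ (Cabs_abs_Im a Ha)).
  assert (Series (fun n => Rabs (Re (a n))) <= Series b)%R.
  { apply Series_le; [ intro n; split; [ apply Rabs_pos | ] | exact Hb ].
    eapply Rle_trans; [ apply re_le_Cmod | apply H ]. }
  assert (Series (fun n => Rabs (Im (a n))) <= Series b)%R.
  { apply Series_le; [ intro n; split; [ apply Rabs_pos | ] | exact Hb ].
    eapply Rle_trans; [ apply im_le_Cmod | apply H ]. }
  lra.
Qed.

(** Reduces a linear relation between series to a rational identity between their terms, once a
    certificate [G] is known. Both special relations at argument 1/2 are obtained this way. *)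
Lemma Cser_telescope (a G : nat -> C) :
  Cabs a -> (forall n, a n = G n - G (S n)) -> Clim G 0 -> Cser a = G O.
Proof.
  intros Ha HG H0.
  apply Clim_unique with (1 := Cser_lim a Ha).
  apply Clim_ext with (u := fun n => G O - G (S n)).
  { intro n; induction n.
    - rewrite sum_O, HG; reflexivity.
    - rewrite sum_Sn, <- IHn, HG; unfold plus; simpl; ring. }
  replace (G O) with (G O - 0) at 1 by ring.
  apply Clim_minus; [ apply Clim_const | apply (Clim_incr_1 G), H0 ].
Qed.

(** * Complex-valued functions of a real variable *)

Definition Cder (f : R -> C) (x : R) (l : C) : Prop :=
  is_derive (fun t => Re (f t)) x (Re l) /\ is_derive (fun t => Im (f t)) x (Im l).

Lemma Cder_ext (f g : R -> C) (x : R) (l : C) :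
  (forall t, f t = g t) -> Cder f x l -> Cder g x l.
Proof.
  intros H [H1 H2]; split; (eapply is_derive_ext; [ | eassumption ]);
    intro t; simpl; rewrite H; reflexivity.
Qed.

Lemma Cder_const (c : C) (x : R) : Cder (fun _ => c) x 0.
Proof. split; apply (is_derive_const (K := R_AbsRing) (V := R_NormedModule)). Qed.

Lemma Cder_plus (f g : R -> C) (x : R) (l m : C) :
  Cder f x l -> Cder g x m -> Cder (fun t => f t + g t) x (l + m).
Proof.
  intros [H1 H2] [H3 H4]; split; simpl.
  - apply (is_derive_plus (K := R_AbsRing) (V := R_NormedModule) _ _ _ _ _ H1 H3).
  - apply (is_derive_plus (K := R_AbsRing) (V := R_NormedModule) _ _ _ _ _ H2 H4).
Qed.

Lemma is_derive_mult_R (f g : R -> R) (x l m : R) :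
  is_derive f x l -> is_derive g x m ->
  is_derive (fun t => f t * g t)%R x (l * g x + f x * m)%R.
Proof.
  intros; apply (is_derive_mult f g x l m); auto; intros; apply Rmult_comm.
Qed.

Lemma Cder_mult (f g : R -> C) (x : R) (l m : C) :
  Cder f x l -> Cder g x m -> Cder (fun t => f t * g t) x (l * g x + f x * m).
Proof.
  intros [H1 H2] [H3 H4]; split; simpl.
  - match goal with |- is_derive _ _ ?d =>
      replace d with
        ((Re l * Re (g x) + Re (f x) * Re m) - (Im l * Im (g x) + Im (f x) * Im m))%R
        by (unfold Re, Im; ring) end.
    apply (is_derive_minus (K := R_AbsRing) (V := R_NormedModule)
             (fun t => Re (f t) * Re (g t))%R (fun t => Im (f t) * Im (g t))%R);
      apply is_derive_mult_R; assumption.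
  - match goal with |- is_derive _ _ ?d =>
      replace d with
        ((Re l * Im (g x) + Re (f x) * Im m) + (Im l * Re (g x) + Im (f x) * Re m))%R
        by (unfold Re, Im; ring) end.
    apply (is_derive_plus (K := R_AbsRing) (V := R_NormedModule)
             (fun t => Re (f t) * Im (g t))%R (fun t => Im (f t) * Re (g t))%R);
      apply is_derive_mult_R; assumption.
Qed.

Lemma Cder_RtoC (f : R -> R) (x l : R) : is_derive f x l -> Cder (fun t => RtoC (f t)) x l.
Proof.
  intro H; split; simpl; [ exact H | ].
  apply (is_derive_const (K := R_AbsRing) (V := R_NormedModule)).
Qed.

(** For complex values there is no single intermediate point, so the mean value theorem is applied
    to each component; adding the two bounds costs the factor 2. *)
Lemma Cmean_value_le (f df : R -> C) (a b K : R) :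
  (a <= b)%R ->
  (forall x, a <= x <= b -> Cder f x (df x))%R ->
  (forall x, a <= x <= b -> Cmod (df x) <= K)%R ->
  (Cmod (f b - f a) <= 2 * K * (b - a))%R.
Proof.
  intros Hab Hd Hb.
  assert (G : forall p : C -> R, (forall z, Rabs (p z) <= Cmod z)%R ->
    (forall x, a <= x <= b -> is_derive (fun t => p (f t)) x (p (df x)))%R ->
    (Rabs (p (f b) - p (f a)) <= K * (b - a))%R).
  { intros p Hp Hdp.
    destruct (MVT_gen (fun t => p (f t)) a b (fun t => p (df t))) as [c [Hc E]].
    - rewrite Rmin_left, Rmax_right by assumption; intros x Hx; apply Hdp; lra.
    - rewrite Rmin_left, Rmax_right by assumption; intros x Hx.
      apply continuity_pt_filterlim, (ex_derive_continuous (K := R_AbsRing) (V := R_NormedModule)).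
      exists (p (df x)); apply Hdp, Hx.
    - rewrite Rmin_left, Rmax_right in Hc by assumption.
      rewrite E, Rabs_mult, (Rabs_pos_eq (b - a)) by lra.
      apply Rmult_le_compat_r; [ lra | ].
      eapply Rle_trans; [ apply Hp | apply Hb, Hc ]. }
  eapply Rle_trans; [ apply Cmod_le_re_im | ].
  pose proof (G Re re_le_Cmod (fun x Hx => proj1 (Hd x Hx))) as H1.
  pose proof (G Im im_le_Cmod (fun x Hx => proj2 (Hd x Hx))) as H2.
  change (Re (f b - f a)) with (Re (f b) - Re (f a))%R.
  change (Im (f b - f a)) with (Im (f b) - Im (f a))%R.
  lra.
Qed.

(** * Complex exponential and powers *)

Lemma Cexp_plus (z w : C) : Cexp (z + w) = Cexp z * Cexp w.
Proof.
  unfold Cexp, Re, Im; apply C_ext; simpl; rewrite exp_plus.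
  - rewrite cos_plus; ring.
  - rewrite sin_plus; ring.
Qed.

Lemma Cexp_0 : Cexp 0 = 1.
Proof. unfold Cexp; apply C_ext; simpl; rewrite exp_0, ?cos_0, ?sin_0; ring. Qed.

Lemma Cmod_Cexp (z : C) : Cmod (Cexp z) = exp (Re z).
Proof.
  replace (Cexp z) with (RtoC (exp (Re z)) * (cos (Im z), sin (Im z)))
    by (apply C_ext; unfold Cexp, Re, Im; simpl; ring).
  rewrite Cmod_mult, Cmod_R, Rabs_pos_eq by (left; apply exp_pos).
  replace (Cmod (cos (Im z), sin (Im z))) with 1%R; [ ring | ].
  unfold Cmod; simpl.
  pose proof (sin2_cos2 (Im z)) as H; unfold Rsqr in H.
  transitivity (sqrt 1); [ symmetry; apply sqrt_1 | f_equal; lra ].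
Qed.

Lemma Cexp_neq_0 (z : C) : Cexp z <> 0.
Proof. apply Cmod_gt_0; rewrite Cmod_Cexp; apply exp_pos. Qed.

Lemma Cpowr_plus (a : R) (z w : C) : Cpowr a (z + w) = Cpowr a z * Cpowr a w.
Proof. unfold Cpowr; rewrite <- Cexp_plus; f_equal; ring. Qed.

Lemma Cpowr_neq_0 (a : R) (z : C) : Cpowr a z <> 0.
Proof. apply Cexp_neq_0. Qed.

Lemma Cpowr_0 (a : R) : Cpowr a 0 = 1.
Proof. unfold Cpowr; replace (ln a * 0) with (RtoC 0) by ring; apply Cexp_0. Qed.

Lemma Cpowr_opp (a : R) (z : C) : Cpowr a (- z) = / Cpowr a z.
Proof.
  pose proof (Cpowr_neq_0 a z).
  replace (Cpowr a (- z)) with (Cpowr a (- z + z) / Cpowr a z)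
    by (rewrite Cpowr_plus; field; assumption).
  replace (- z + z) with (RtoC 0) by ring; rewrite Cpowr_0; field; assumption.
Qed.

Lemma Cpowr_minus (a : R) (z w : C) : Cpowr a (z - w) = Cpowr a z / Cpowr a w.
Proof. unfold Cminus; rewrite Cpowr_plus, Cpowr_opp; reflexivity. Qed.

Lemma Cpowr_base_mult (a b : R) (z : C) :
  (0 < a)%R -> (0 < b)%R -> Cpowr (a * b) z = Cpowr a z * Cpowr b z.
Proof.
  intros; unfold Cpowr; rewrite <- Cexp_plus, ln_mult, RtoC_plus by assumption.
  f_equal; ring.
Qed.

Lemma Cpowr_1 (a : R) : (0 < a)%R -> Cpowr a 1 = RtoC a.
Proof.
  intro Ha; unfold Cpowr; rewrite <- RtoC_mult; unfold Cexp; simpl.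
  rewrite Rmult_1_r, exp_ln, cos_0, sin_0 by assumption; unfold RtoC; f_equal; ring.
Qed.

Lemma Cpowr_INR (a : R) (n : nat) : (0 < a)%R -> Cpowr a (RtoC (INR n)) = RtoC a ^ n.
Proof.
  intro Ha; induction n.
  - simpl; apply Cpowr_0.
  - rewrite S_INR, RtoC_plus, Cpowr_plus, IHn, Cpowr_1, Cpow_S by assumption; ring.
Qed.

Lemma Cmod_Cpowr (a : R) (z : C) : Cmod (Cpowr a z) = exp (ln a * Re z).
Proof. unfold Cpowr; rewrite Cmod_Cexp; f_equal; unfold Re; simpl; ring. Qed.

Lemma Cder_Cpowr (g : R -> R) (x l : R) (z : C) :
  (0 < g x)%R -> is_derive g x l ->
  Cder (fun t => Cpowr (g t) z) x (RtoC l * z * Cpowr (g x) (z - 1)).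
Proof.
  intros Hg Hd.
  rewrite Cpowr_minus, Cpowr_1 by assumption.
  unfold Cpowr, Cexp; split; simpl.
  - evar_last.
    { auto_derive.
      - repeat split; try assumption; exists l; exact Hd.
      - replace (Derive (fun t => g t) x) with l
          by (symmetry; apply is_derive_unique, Hd); reflexivity. }
    unfold Re, Im, Rminus; simpl; field; lra.
  - evar_last.
    { auto_derive.
      - repeat split; try assumption; exists l; exact Hd.
      - replace (Derive (fun t => g t) x) with l
          by (symmetry; apply is_derive_unique, Hd); reflexivity. }
    unfold Re, Im, Rminus; simpl; field; lra.
Qed.

Lemma Clim_Cpowr (u : nat -> R) (l : R) (z : C) :
  (0 < l)%R -> is_lim_seq u l -> Clim (fun n => Cpowr (u n) z) (Cpowr l z).
Proof.
  intros Hl Hu.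
  pose proof (Cder_Cpowr (fun t => t) l 1 z Hl (is_derive_id l)) as [H1 H2].
  split.
  - apply (is_lim_seq_continuous (fun t => Re (Cpowr t z))); [ | exact Hu ].
    apply continuity_pt_filterlim, (ex_derive_continuous (K := R_AbsRing) (V := R_NormedModule)).
    eexists; exact H1.
  - apply (is_lim_seq_continuous (fun t => Im (Cpowr t z))); [ | exact Hu ].
    apply continuity_pt_filterlim, (ex_derive_continuous (K := R_AbsRing) (V := R_NormedModule)).
    eexists; exact H2.
Qed.


(** * The reciprocal Gamma function *)

Lemma INR_gt_0 (n : nat) : (1 <= n)%nat -> (0 < INR n)%R.
Proof. intro H; apply lt_0_INR; lia. Qed.

(** An infinite product with factors 1 + O(1/n^2) converges. The bound is on increments rather than
    quotients because [p] may vanish from some index on, as the inverted Gauss sequence does at a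
    pole of Gamma. The form K / (n (n + 1)) = K / n - K / (n + 1) makes all estimates telescope. *)
Lemma Clim_of_ratio (p : nat -> C) (K : R) (N : nat) :
  (0 <= K)%R -> (1 <= N)%nat ->
  (forall n, (N <= n)%nat ->
     Cmod (p (S n) - p n) <= K / (INR n * INR (S n)) * Cmod (p n))%R ->
  exists l, Clim p l.
Proof.
  intros HK HN H.
  set (B := (Cmod (p N) * exp (K / INR N))%R).
  assert (HB : (0 <= B)%R).
  { apply Rmult_le_pos; [ apply Cmod_ge_0 | left; apply exp_pos ]. }
  (* [|p n| exp (K / n)] is nonincreasing,
     as [1 + K / (n (n + 1)) <= exp (K / n - K / (n + 1))]. *)
  assert (Hb : forall n, (N <= n)%nat -> (Cmod (p n) * exp (K / INR n) <= B)%R).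
  { intros n Hn; induction Hn as [ | n Hn IH ]; [ apply Rle_refl | ].
    eapply Rle_trans; [ | exact IH ].
    assert (Hp : (0 < INR n)%R) by (apply INR_gt_0; lia).
    assert (Hp' : (0 < INR (S n))%R) by (apply INR_gt_0; lia).
    assert (E : (exp (K / INR n)
                 = exp (K / (INR n * INR (S n))) * exp (K / INR (S n)))%R).
    { rewrite <- exp_plus; f_equal; rewrite S_INR in *; field; lra. }
    rewrite E, <- Rmult_assoc.
    apply Rmult_le_compat_r; [ left; apply exp_pos | ].
    apply Rle_trans with (Cmod (p n) * (1 + K / (INR n * INR (S n))))%R.
    - replace (p (S n)) with (p n + (p (S n) - p n)) by ring.
      eapply Rle_trans; [ apply Cmod_triangle | ].
      specialize (H n Hn); lra.
    - apply Rmult_le_compat_l; [ apply Cmod_ge_0 | apply exp_ineq1_le ]. }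
  assert (Hb' : forall n, (N <= n)%nat -> (Cmod (p n) <= B)%R).
  { intros n Hn; eapply Rle_trans; [ | apply (Hb n Hn) ].
    rewrite <- (Rmult_1_r (Cmod (p n))) at 1.
    apply Rmult_le_compat_l; [ apply Cmod_ge_0 | ].
    pose proof (exp_ineq1_le (K / INR n)).
    assert (0 <= K / INR n)%R; [ | lra ].
    apply Rdiv_le_0_compat; [ assumption | apply INR_gt_0; lia ]. }
  assert (Hc : forall n m, (N <= n)%nat -> (n <= m)%nat ->
    (Cmod (p m - p n) <= K * B * (/ INR n - / INR m))%R).
  { intros n m Hn Hm; induction Hm as [ | m Hm IH ].
    - replace (p n - p n) with (RtoC 0) by ring; rewrite Cmod_0; lra.
    - replace (p (S m) - p n) with ((p (S m) - p m) + (p m - p n)) by ring.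
      eapply Rle_trans; [ apply Cmod_triangle | ].
      assert (Hp : (0 < INR m)%R) by (apply INR_gt_0; lia).
      assert (Hp' : (0 < INR (S m))%R) by (apply INR_gt_0; lia).
      assert (Hq : (0 <= K / (INR m * INR (S m)))%R).
      { apply Rdiv_le_0_compat; [ assumption | apply Rmult_lt_0_compat; assumption ]. }
      pose proof (H m ltac:(lia)) as H1.
      pose proof (Rmult_le_compat_l _ _ _ Hq (Hb' m ltac:(lia))) as H2.
      replace (K * B * (/ INR n - / INR (S m)))%R
        with (K / (INR m * INR (S m)) * B + K * B * (/ INR n - / INR m))%R; [ lra | ].
      rewrite S_INR in *; field; repeat split; try lra.
      apply Rgt_not_eq, INR_gt_0; lia. }
  assert (Hc' : forall n m, (N <= n)%nat -> (n <= m)%nat ->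
    (Cmod (p m - p n) <= K * B / INR n)%R).
  { intros n m Hn Hm; eapply Rle_trans; [ apply Hc; assumption | ].
    unfold Rdiv; apply Rmult_le_compat_l; [ apply Rmult_le_pos; assumption | ].
    assert (0 < / INR m)%R by (apply Rinv_0_lt_compat, INR_gt_0; lia); lra. }
  assert (G : forall f : C -> R, (forall z w : C, f (z - w)%C = (f z - f w)%R) ->
    (forall z, Rabs (f z) <= Cmod z)%R -> ex_finite_lim_seq (fun n => f (p n))).
  { intros f Hf Hm; apply ex_lim_seq_cauchy_corr; intros [e He].
    destruct (archimed_cor1 (e / (K * B + 1))) as [M [HM HM0]].
    { apply Rdiv_lt_0_compat; [ assumption | ].
      pose proof (Rmult_le_pos _ _ HK HB); lra. }
    assert (HM' : (K * B / INR M < e)%R).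
    { pose proof (Rmult_le_pos _ _ HK HB).
      assert (0 < INR M)%R by (apply lt_0_INR; lia).
      apply Rle_lt_trans with ((K * B + 1) / INR M)%R.
      - unfold Rdiv; apply Rmult_le_compat_r; [ left; apply Rinv_0_lt_compat; assumption | lra ].
      - apply Rmult_lt_reg_l with (/ (K * B + 1))%R; [ apply Rinv_0_lt_compat; lra | ].
        replace (/ (K * B + 1) * ((K * B + 1) / INR M))%R with (/ INR M)%R by (field; lra).
        replace (/ (K * B + 1) * e)%R with (e / (K * B + 1))%R by (field; lra).
        exact HM. }
    assert (W : forall n m, (Nat.max N M <= n)%nat -> (n <= m)%nat ->
      (Rabs (f (p m) - f (p n)) < e)%R).
    { intros n m Hn Hnm; rewrite <- Hf.
      eapply Rle_lt_trans; [ apply Hm | ].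
      eapply Rle_lt_trans; [ apply Hc'; lia | ].
      eapply Rle_lt_trans; [ | exact HM' ].
      unfold Rdiv; apply Rmult_le_compat_l; [ apply Rmult_le_pos; assumption | ].
      apply Rinv_le_contravar; [ apply INR_gt_0; lia | apply le_INR; lia ]. }
    exists (Nat.max N M); intros n m Hn Hnm; simpl.
    destruct (Nat.le_ge_cases n m).
    - rewrite Rabs_minus_sym; apply W; assumption.
    - apply W; assumption. }
  destruct (G Re) as [a Ha]; [ reflexivity | apply re_le_Cmod | ].
  destruct (G Im) as [b Hb2]; [ reflexivity | apply im_le_Cmod | ].
  exists (a, b); split; assumption.
Qed.

(** The inverted Gauss sequence. Its factors have no denominators depending on z, and it converges
    at the poles of Gamma too, to 0. *)
Definition rgauss_seq (z : C) (n : nat) : C :=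
  poch z (S n) / (Cpowr (INR n) z * RtoC (INR (fact n))).

Definition rGamma (z : C) : C :=
  (real (Lim_seq (fun n => Re (rgauss_seq z n))),
   real (Lim_seq (fun n => Im (rgauss_seq z n)))).

Lemma Clim_Lim_seq (u : nat -> C) (l : C) :
  Clim u l -> l = (real (Lim_seq (fun n => Re (u n))), real (Lim_seq (fun n => Im (u n)))).
Proof.
  intros [H1 H2]; apply is_lim_seq_unique in H1, H2.
  rewrite H1, H2; apply C_ext; reflexivity.
Qed.

Lemma RtoC_neq_0 (x : R) : x <> 0%R -> RtoC x <> 0.
Proof. intros H E; apply H; injection E; auto. Qed.

Lemma Cinv_neq_0 (z : C) : z <> 0 -> / z <> 0.
Proof.
  intros Hz E; pose proof (Cinv_r z Hz) as H.
  rewrite E, Cmult_0_r in H; injection H; lra.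
Qed.

Lemma INR_fact_neq_0_C (n : nat) : RtoC (INR (fact n)) <> 0.
Proof. apply RtoC_neq_0, INR_fact_neq_0. Qed.

Lemma INR_S_neq_0_C (n : nat) : RtoC (INR (S n)) <> 0.
Proof. apply RtoC_neq_0, not_0_INR; lia. Qed.

Lemma INR_fact_S_C (n : nat) :
  RtoC (INR (fact (S n))) = RtoC (INR n + 1) * RtoC (INR (fact n)).
Proof.
  change (fact (S n)) with (S n * fact n)%nat.
  rewrite mult_INR, S_INR, RtoC_mult; reflexivity.
Qed.

Lemma ln_abs_le (x : R) : (1 / 2 <= x <= 1)%R -> (Rabs (ln x) <= ln 2)%R.
Proof.
  intros [H1 H2].
  assert (ln x <= 0)%R by (rewrite <- ln_1; apply ln_le; lra).
  assert (- ln 2 <= ln x)%R.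
  { rewrite <- ln_Rinv by lra; apply ln_le; lra. }
  rewrite Rabs_left1 by assumption; lra.
Qed.

(* The derivative in [h] is [- z (z + 1) h (1 - h) ^ (z - 1)], which vanishes at [0]. *)
Lemma gauss_ratio_bound (z : C) : exists K, (0 <= K)%R /\
  forall h, (0 <= h <= 1 / 2)%R ->
  (Cmod (Cpowr (1 - h) z * (1 + z * RtoC h) - 1) <= K * h ^ 2)%R.
Proof.
  (* The exponential bounds |(1 - t)^(z - 1)| for t in [0, 1/2]. One factor h comes from the zero of
     the derivative at 0, the other from the length of the interval. *)
  set (M := (exp (ln 2 * Rabs (Re (z - 1))) * Cmod (z * (z + 1)))%R).
  assert (HM : (0 <= M)%R).
  { apply Rmult_le_pos; [ left; apply exp_pos | apply Cmod_ge_0 ]. }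
  exists (2 * M)%R; split; [ lra | ]; intros h Hh.
  pose proof (Cmean_value_le
    (fun t => Cpowr (1 - t) z * (1 + z * RtoC t))
    (fun t => - (z * (z + 1)) * RtoC t * Cpowr (1 - t) (z - 1)) 0 h (M * h)) as H.
  simpl in H.
  replace (Cpowr (1 - 0) z * (1 + z * 0)) with (RtoC 1) in H.
  2: { unfold Cpowr; rewrite Rminus_0_r, ln_1.
       replace (0 * z) with (RtoC 0) by ring; rewrite Cexp_0; ring. }
  replace (2 * M * h ^ 2)%R with (2 * (M * h) * (h - 0))%R by ring.
  apply H; [ lra | | ].
  - intros x Hx.
    assert (D1 : Cder (fun t => Cpowr (1 - t) z) x (RtoC (-1) * z * Cpowr (1 - x) (z - 1))).
    { apply (Cder_Cpowr (fun t => 1 - t)%R); [ lra | ].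
      auto_derive; [ exact I | ring ]. }
    assert (D2 : Cder (fun t => 1 + z * RtoC t) x (0 + (0 * RtoC x + z * 1))).
    { apply Cder_plus; [ apply Cder_const | ].
      apply Cder_mult; [ apply Cder_const | apply Cder_RtoC; auto_derive; [ exact I | ring ] ]. }
    pose proof (Cder_mult _ _ _ _ _ D1 D2) as D3; simpl in D3.
    match type of D3 with Cder _ _ ?d =>
      replace (- (z * (z + 1)) * x * Cpowr (1 - x) (z - 1)) with d; [ exact D3 | ] end.
    replace (Cpowr (1 - x) z) with (Cpowr (1 - x) (z - 1) * (1 - x)).
    + ring.
    + rewrite <- RtoC_minus, Cpowr_minus, Cpowr_1 by lra; field.
      apply RtoC_neq_0; lra.
  - intros x Hx; rewrite !Cmod_mult, Cmod_opp, Cmod_R, (Rabs_pos_eq x), Cmod_Cpowr by lra.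
    replace (M * h)%R with
      (Cmod (z * (z + 1)) * h * exp (ln 2 * Rabs (Re (z - 1))))%R by (unfold M; ring).
    pose proof (Cmod_ge_0 (z * (z + 1))).
    apply Rmult_le_compat.
    + apply Rmult_le_pos; lra.
    + left; apply exp_pos.
    + apply Rmult_le_compat_l; lra.
    + assert (ln (1 - x) * Re (z - 1) <= ln 2 * Rabs (Re (z - 1)))%R as HH.
      { eapply Rle_trans; [ apply Rle_abs | rewrite Rabs_mult ].
        apply Rmult_le_compat_r; [ apply Rabs_pos | apply ln_abs_le; lra ]. }
      destruct HH as [HH | HH]; [ left; apply exp_increasing, HH | rewrite HH; lra ].
Qed.

Lemma rgauss_seq_S (z : C) (n : nat) : (1 <= n)%nat ->
  rgauss_seq z (S n)
  = rgauss_seq z n * (Cpowr (1 - / INR (S n)) z * (1 + z * RtoC (/ INR (S n)))).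
Proof.
  intro Hn; unfold rgauss_seq.
  change (poch z (S (S n))) with (poch z (S n) * (z + RtoC (INR (S n)))).
  assert (Hp : (0 < INR n)%R) by (apply INR_gt_0; assumption).
  replace (Cpowr (INR n) z)
    with (Cpowr (1 - / INR (S n)) z * Cpowr (INR (S n)) z).
  - rewrite INR_fact_S_C, S_INR, RtoC_inv by lra.
    field; repeat split; try apply Cpowr_neq_0; try apply INR_fact_neq_0_C.
    apply RtoC_neq_0; lra.
  - rewrite <- Cpowr_base_mult.
    + f_equal; rewrite S_INR; field; lra.
    + rewrite S_INR; apply Rlt_0_minus, Rmult_lt_reg_r with (INR n + 1)%R; [ lra | ].
      rewrite Rinv_l; lra.
    + rewrite S_INR; lra.
Qed.

Lemma rgauss_seq_ratio (z : C) : exists K, (0 <= K)%R /\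
  forall n, (1 <= n)%nat ->
  (Cmod (rgauss_seq z (S n) - rgauss_seq z n)
   <= K / (INR n * INR (S n)) * Cmod (rgauss_seq z n))%R.
Proof.
  destruct (gauss_ratio_bound z) as [K [HK H]].
  exists K; split; [ assumption | ]; intros n Hn.
  rewrite rgauss_seq_S by assumption.
  match goal with |- (Cmod (?p * ?q - ?p) <= _)%R =>
    replace (p * q - p) with ((q - 1) * p) by ring end.
  rewrite Cmod_mult; apply Rmult_le_compat_r; [ apply Cmod_ge_0 | ].
  assert (Hp : (1 <= INR n)%R) by (apply (le_INR 1); assumption).
  eapply Rle_trans; [ apply H | ].
  - rewrite S_INR; split.
    + left; apply Rinv_0_lt_compat; lra.
    + replace (1 / 2)%R with (/ 2)%R by field; apply Rinv_le_contravar; lra.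
  - unfold Rdiv; apply Rmult_le_compat_l; [ assumption | ].
    rewrite pow_inv; apply Rinv_le_contravar; rewrite S_INR; nra.
Qed.

Lemma rGamma_lim (z : C) : Clim (rgauss_seq z) (rGamma z).
Proof.
  destruct (rgauss_seq_ratio z) as [K [HK H]].
  destruct (Clim_of_ratio (rgauss_seq z) K 1 HK ltac:(lia) H) as [l Hl].
  unfold rGamma; rewrite <- (Clim_Lim_seq _ _ Hl); exact Hl.
Qed.

Lemma poch_neq_0 (z : C) (n : nat) : ~ nonpos_int z -> poch z n <> 0.
Proof.
  intro Hz; induction n; simpl.
  - apply RtoC_neq_0; lra.
  - apply Cmult_neq_0; [ assumption | ].
    intro E; apply Hz; exists n; rewrite RtoC_opp.
    replace z with (z + RtoC (INR n) - RtoC (INR n)) by ring; rewrite E; ring.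
Qed.

Lemma gauss_seq_inv (z : C) (n : nat) :
  ~ nonpos_int z -> gauss_seq z n = / rgauss_seq z n.
Proof.
  intro Hz; unfold gauss_seq, rgauss_seq.
  pose proof (poch_neq_0 z (S n) Hz); pose proof (Cpowr_neq_0 (INR n) z).
  pose proof (INR_fact_neq_0_C n).
  field; auto.
Qed.

Lemma rgauss_seq_neq_0 (z : C) (n : nat) : ~ nonpos_int z -> rgauss_seq z n <> 0.
Proof.
  intro Hz; unfold rgauss_seq, Cdiv; apply Cmult_neq_0; [ apply poch_neq_0, Hz | ].
  apply Cinv_neq_0, Cmult_neq_0; [ apply Cpowr_neq_0 | apply INR_fact_neq_0_C ].
Qed.

(** Inverting a sequence with small relative increments at most doubles the relative increments, so
    the same criterion applies with 2K. A finite limit here, multiplied by [rGamma z], gives 1; this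
    is how [rGamma z] is seen to be nonzero. *)
Lemma gauss_seq_cvg (z : C) : ~ nonpos_int z -> exists l, Clim (gauss_seq z) l.
Proof.
  intro Hz; destruct (rgauss_seq_ratio z) as [K [HK H]].
  (* From n > 2K + 1 on, K / (n (n + 1)) is at most 1/2, so consecutive terms of the inverted
     sequence satisfy |p| <= 2 |q|. *)
  destruct (archimed_cor1 (/ (2 * K + 1))) as [N [HN HN0]].
  { apply Rinv_0_lt_compat; lra. }
  apply Clim_of_ratio with (K := (2 * K)%R) (N := N); [ lra | lia | ].
  intros n Hn; rewrite !gauss_seq_inv by assumption.
  specialize (H n ltac:(lia)).
  pose proof (rgauss_seq_neq_0 z n Hz) as H1.
  pose proof (rgauss_seq_neq_0 z (S n) Hz) as H2.
  set (p := rgauss_seq z n) in *; set (q := rgauss_seq z (S n)) in *.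
  set (a := (/ (INR n * INR (S n)))%R) in *.
  assert (HNr : (2 * K + 1 < INR N)%R).
  { apply Rinv_lt_cancel; [ apply lt_0_INR; lia | assumption ]. }
  assert (HnN : (INR N <= INR n)%R) by (apply le_INR; assumption).
  assert (Hpos : (0 < INR n * INR (S n))%R) by (rewrite S_INR; nra).
  assert (Ha0 : (0 < a)%R) by (apply Rinv_0_lt_compat; assumption).
  assert (Ha : (K * a <= 1 / 2)%R).
  { apply Rmult_le_reg_r with (INR n * INR (S n))%R; [ assumption | ].
    unfold a; rewrite Rmult_assoc, Rinv_l by lra; rewrite S_INR; nra. }
  unfold Rdiv in *; fold a in H; fold a.
  assert (Hp : (0 < Cmod p)%R) by (apply Cmod_gt_0; assumption).
  assert (Hq : (Cmod p <= 2 * Cmod q)%R).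
  { assert (Cmod p <= Cmod q + Cmod (q - p))%R.
    { replace p with (q + - (q - p)) at 1 by ring.
      eapply Rle_trans; [ apply Cmod_triangle | rewrite Cmod_opp; lra ]. }
    assert (K * a * Cmod p <= 1 / 2 * Cmod p)%R by (apply Rmult_le_compat_r; lra).
    lra. }
  replace (/ q - / p) with (- (q - p) * / p * / q) by (field; auto).
  rewrite !Cmod_mult, Cmod_opp, !Cmod_inv by assumption.
  assert (Hq0 : (0 < Cmod q)%R) by lra.
  rewrite Rmult_comm, <- Rmult_assoc.
  apply Rmult_le_compat_r; [ left; apply Rinv_0_lt_compat; assumption | ].
  apply Rmult_le_reg_l with (Cmod q); [ assumption | ].
  rewrite <- Rmult_assoc, Rinv_r, Rmult_1_l by lra.
  eapply Rle_trans; [ exact H | ].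
  assert (0 <= K * a)%R by nra; nra.
Qed.

Lemma rGamma_CGamma (z : C) :
  ~ nonpos_int z -> rGamma z <> 0 /\ CGamma z = / rGamma z.
Proof.
  intro Hz; destruct (gauss_seq_cvg z Hz) as [l Hl].
  assert (E : rGamma z * l = 1).
  { apply Clim_unique with (u := fun _ => RtoC 1); [ | apply Clim_const ].
    eapply Clim_ext; [ | apply Clim_mult; [ apply rGamma_lim | exact Hl ] ].
    intro n; simpl; rewrite gauss_seq_inv by assumption.
    apply Cinv_r, rgauss_seq_neq_0, Hz. }
  assert (H0 : rGamma z <> 0).
  { intro H; rewrite H, Cmult_0_l in E; injection E; lra. }
  split; [ assumption | ].
  unfold CGamma; rewrite <- (Clim_Lim_seq _ _ Hl).
  replace l with (rGamma z * l / rGamma z) by (field; assumption).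
  rewrite E; field; assumption.
Qed.

Lemma poch_S_l (z : C) (n : nat) : poch z (S n) = z * poch (z + 1) n.
Proof.
  induction n; [ simpl; ring | ].
  change (poch z (S (S n))) with (poch z (S n) * (z + RtoC (INR (S n)))).
  rewrite IHn, S_INR, RtoC_plus; simpl; ring.
Qed.

(** The Gauss sequences of z and z + 1 differ by the factor (z + n + 1) / n, up to z, and this tends
    to 1. No division by z occurs, so poles are included. *)
Lemma rGamma_step (z : C) : rGamma z = z * rGamma (z + 1).
Proof.
  symmetry; apply Clim_unique with (u := fun n => z * rgauss_seq (z + 1) n).
  { apply Clim_mult; [ apply Clim_const | apply rGamma_lim ]. }
  apply Clim_ext_loc with
    (u := fun n => rgauss_seq z n * (1 + (z + 1) * RtoC (/ INR n))).
  { exists 1%nat; intros n Hn; unfold rgauss_seq.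
    assert (Hp : (0 < INR n)%R) by (apply INR_gt_0; assumption).
    rewrite Cpowr_plus, Cpowr_1, RtoC_inv by lra.
    replace (z * (poch (z + 1) (S n) / (Cpowr (INR n) z * INR n * INR (fact n))))
      with (poch z (S (S n)) / (Cpowr (INR n) z * INR n * INR (fact n)))
      by (rewrite (poch_S_l z (S n)); unfold Cdiv; ring).
    change (poch z (S (S n))) with (poch z (S n) * (z + RtoC (INR (S n)))).
    rewrite S_INR, RtoC_plus; field; repeat split.
    - apply INR_fact_neq_0_C.
    - apply RtoC_neq_0; lra.
    - apply Cpowr_neq_0. }
  replace (rGamma z) with (rGamma z * (1 + (z + 1) * 0)) by ring.
  apply Clim_mult; [ apply rGamma_lim | ].
  apply Clim_plus; [ apply Clim_const | ].
  apply Clim_mult; [ apply Clim_const | ].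
  split; simpl; [ | apply is_lim_seq_const ].
  replace 0%R with (real (Rbar_inv p_infty)) by reflexivity.
  apply (is_lim_seq_inv INR p_infty); [ apply is_lim_seq_INR | discriminate ].
Qed.

Lemma rGamma_poch (z : C) (n : nat) : rGamma z = poch z n * rGamma (z + RtoC (INR n)).
Proof.
  induction n.
  - simpl; replace (z + 0) with z by ring; ring.
  - rewrite IHn, (rGamma_step (z + INR n)), S_INR, RtoC_plus, Cplus_assoc; simpl; ring.
Qed.


(** * Power series with coefficients of subexponential growth *)

(** Radius of convergence at least 1, in the form limsup |a_n|^(1/n) <= 1. This form passes to
    termwise products and shifts and yields explicit geometric majorants. *)
Definition subexp (a : nat -> C) : Prop :=
  forall rho : R, (1 < rho)%R ->
  exists M : R, forall n, (Cmod (a n) <= M * rho ^ n)%R.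

Lemma subexp_ratio (a : nat -> C) :
  (forall rho : R, (1 < rho)%R ->
     exists N, forall n, (N <= n)%nat -> (Cmod (a (S n)) <= rho * Cmod (a n))%R) ->
  subexp a.
Proof.
  intros H rho Hr; destruct (H rho Hr) as [N HN].
  assert (Hinit : exists M, forall n, (n <= N)%nat -> (Cmod (a n) <= M * rho ^ n)%R).
  { clear HN; induction N as [ | N [M HM] ].
    - exists (Cmod (a O)); intros n Hn.
      replace n with O by lia; simpl; lra.
    - exists (Rmax M (Cmod (a (S N)) / rho ^ S N)); intros n Hn.
      assert (Hp : forall k, (0 < rho ^ k)%R) by (intro; apply pow_lt; lra).
      destruct (Nat.eq_dec n (S N)) as [-> | Hne].
      + apply Rle_trans with (Cmod (a (S N)) / rho ^ S N * rho ^ S N)%R.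
        * right; field; apply Rgt_not_eq, (Hp (S N)).
        * apply Rmult_le_compat_r; [ left; apply Hp | apply Rmax_r ].
      + eapply Rle_trans; [ apply HM; lia | ].
        apply Rmult_le_compat_r; [ left; apply Hp | apply Rmax_l ]. }
  destruct Hinit as [M HM]; exists M; intro n.
  destruct (Nat.le_ge_cases n N) as [Hn | Hn]; [ apply HM, Hn | ].
  induction Hn as [ | n Hn IH ]; [ apply HM; lia | ].
  eapply Rle_trans; [ apply HN, Hn | simpl ].
  replace (M * (rho * rho ^ n))%R with (rho * (M * rho ^ n))%R by ring.
  apply Rmult_le_compat_l; [ lra | exact IH ].
Qed.

Lemma subexp_bound_pos (a : nat -> C) (rho : R) : subexp a -> (1 < rho)%R ->
  exists M : R, (0 < M)%R /\ forall n, (Cmod (a n) <= M * rho ^ n)%R.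
Proof.
  intros Ha Hr; destruct (Ha rho Hr) as [M HM].
  exists (Rmax M 1); split.
  - apply Rlt_le_trans with 1%R; [ lra | apply Rmax_r ].
  - intro n; eapply Rle_trans; [ apply HM | ].
    apply Rmult_le_compat_r; [ left; apply pow_lt; lra | apply Rmax_l ].
Qed.

Lemma subexp_ext (a b : nat -> C) : (forall n, a n = b n) -> subexp a -> subexp b.
Proof.
  intros H Ha rho Hr; destruct (Ha rho Hr) as [M HM].
  exists M; intro n; rewrite <- H; apply HM.
Qed.

Lemma subexp_mult (a b : nat -> C) : subexp a -> subexp b -> subexp (fun n => a n * b n).
Proof.
  intros Ha Hb rho Hr.
  assert (Hs : (1 < sqrt rho)%R) by (rewrite <- sqrt_1; apply sqrt_lt_1; lra).
  destruct (subexp_bound_pos a _ Ha Hs) as [M [HM0 HM]].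
  destruct (subexp_bound_pos b _ Hb Hs) as [M' [HM0' HM']].
  exists (M * M')%R; intro n; rewrite Cmod_mult.
  replace (M * M' * rho ^ n)%R with ((M * sqrt rho ^ n) * (M' * sqrt rho ^ n))%R.
  - apply Rmult_le_compat; auto using Cmod_ge_0.
  - rewrite <- (sqrt_sqrt rho) at 3 by lra; rewrite Rpow_mult_distr; ring.
Qed.

Lemma subexp_shift (a : nat -> C) (j : nat) : subexp a -> subexp (fun n => a (j + n)%nat).
Proof.
  intros Ha rho Hr; destruct (Ha rho Hr) as [M HM].
  exists (M * rho ^ j)%R; intro n; eapply Rle_trans; [ apply HM | ].
  rewrite pow_add; lra.
Qed.

Lemma subexp_bounded (a : nat -> C) (K : R) : (forall n, Cmod (a n) <= K)%R -> subexp a.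
Proof.
  intros Ha rho Hr; exists K; intro n.
  pose proof (Ha O); pose proof (Cmod_ge_0 (a O)).
  eapply Rle_trans; [ apply Ha | ].
  rewrite <- (Rmult_1_r K) at 1; apply Rmult_le_compat_l; [ lra | ].
  apply pow_R1_Rle; lra.
Qed.

Lemma exists_INR_ge (x : R) : exists N : nat, forall n, (N <= n)%nat -> (x <= INR n)%R.
Proof.
  destruct (archimed (Rabs x)) as [H1 _].
  exists (Z.to_nat (up (Rabs x))); intros n Hn.
  pose proof (Rle_abs x).
  assert (0 <= up (Rabs x))%Z.
  { apply le_IZR; pose proof (Rabs_pos x); simpl; lra. }
  apply le_INR in Hn; rewrite INR_IZR_INZ, Z2Nat.id in Hn by assumption; lra.
Qed.

Lemma subexp_INR : subexp (fun n => RtoC (INR n)).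
Proof.
  apply subexp_ratio; intros rho Hr.
  destruct (exists_INR_ge (/ (rho - 1))) as [N HN]; exists N; intros n Hn.
  rewrite !Cmod_R, !Rabs_pos_eq by apply pos_INR; rewrite S_INR.
  specialize (HN n Hn).
  apply Rmult_le_compat_l with (r := (rho - 1)%R) in HN; [ | lra ].
  rewrite Rinv_r in HN; lra.
Qed.

Lemma Cmod_plus_INR_ge (c : C) (n : nat) : (INR n - Cmod c <= Cmod (c + RtoC (INR n)))%R.
Proof.
  assert (Cmod (RtoC (INR n)) <= Cmod (c + RtoC (INR n)) + Cmod c)%R.
  { replace (RtoC (INR n)) with (c + RtoC (INR n) + - c) at 1 by ring.
    eapply Rle_trans; [ apply Cmod_triangle | rewrite Cmod_opp; lra ]. }
  rewrite Cmod_R, Rabs_pos_eq in H by apply pos_INR; lra.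
Qed.

(** The ratio (a + n) / (c + n) tends to 1. The cross-multiplied hypothesis makes sense when c + n
    vanishes, so it covers (b)_n / Gamma(d + n) at every d as well as quotients of Pochhammer
    symbols. *)
Lemma subexp_linear_ratio (a c : C) (w : nat -> C) :
  (forall n, (c + RtoC (INR n)) * w (S n) = (a + RtoC (INR n)) * w n) -> subexp w.
Proof.
  intro Hw; apply subexp_ratio; intros rho Hr.
  destruct (exists_INR_ge ((Cmod a + rho * Cmod c) / (rho - 1))) as [N1 HN1].
  destruct (exists_INR_ge (Cmod c + 1)) as [N2 HN2].
  exists (Nat.max N1 N2); intros n Hn.
  specialize (HN1 n ltac:(lia)); specialize (HN2 n ltac:(lia)).
  apply Rmult_le_compat_l with (r := (rho - 1)%R) in HN1; [ | lra ].
  replace ((rho - 1) * ((Cmod a + rho * Cmod c) / (rho - 1)))%R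
    with (Cmod a + rho * Cmod c)%R in HN1 by (field; lra).
  pose proof (Cmod_plus_INR_ge c n) as H2.
  apply Rmult_le_reg_l with (Cmod (c + RtoC (INR n))); [ lra | ].
  rewrite <- Cmod_mult, Hw, Cmod_mult, <- Rmult_assoc.
  apply Rmult_le_compat_r; [ apply Cmod_ge_0 | ].
  pose proof (Cmod_triangle a (RtoC (INR n))) as H1.
  rewrite Cmod_R, Rabs_pos_eq in H1 by apply pos_INR.
  apply Rmult_le_compat_l with (r := rho) in H2; [ | lra ].
  lra.
Qed.

Lemma subexp_poch_ratio (a c : C) : ~ nonpos_int c -> subexp (fun n => poch a n / poch c n).
Proof.
  intro Hc; apply (subexp_linear_ratio a c); intro n.
  pose proof (poch_neq_0 c (S n) Hc) as Hp; simpl in Hp.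
  simpl; field; split.
  - apply poch_neq_0, Hc.
  - intro E; apply Hp; rewrite E; ring.
Qed.

Lemma poch_1_fact (n : nat) : poch 1 n = RtoC (INR (fact n)).
Proof.
  induction n; [ reflexivity | ].
  rewrite INR_fact_S_C; simpl; rewrite IHn, RtoC_plus; ring.
Qed.

Lemma one_not_nonpos_int : ~ nonpos_int 1.
Proof. intros [k Hk]; injection Hk; pose proof (pos_INR k); lra. Qed.

Lemma subexp_poch_fact (a : C) : subexp (fun n => poch a n / RtoC (INR (fact n))).
Proof.
  apply subexp_ext with (a := fun n => poch a n / poch 1 n).
  - intro n; rewrite poch_1_fact; reflexivity.
  - apply subexp_poch_ratio, one_not_nonpos_int.
Qed.

Lemma subexp_Cabs (a : nat -> C) (u : R) :
  subexp a -> (Rabs u < 1)%R -> Cabs (fun n => a n * RtoC (u ^ n)).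
Proof.
  intros Ha Hu; pose proof (Rabs_pos u).
  (* The choice rho = 2 / (1 + |u|) satisfies both rho > 1 and rho |u| < 1. *)
  destruct (Ha (2 / (1 + Rabs u))%R) as [M HM].
  { apply Rmult_lt_reg_r with (1 + Rabs u)%R; [ lra | ].
    unfold Rdiv; rewrite Rmult_assoc, Rinv_l; lra. }
  apply Cabs_le with (b := fun n => (M * (2 / (1 + Rabs u) * Rabs u) ^ n)%R).
  - intro n; rewrite Cmod_mult, Cmod_R, <- RPow_abs, Rpow_mult_distr, <- Rmult_assoc.
    apply Rmult_le_compat_r; [ apply pow_le, Rabs_pos | apply HM ].
  - apply (ex_series_scal_l (V := R_NormedModule)), ex_series_geom.
    rewrite Rabs_pos_eq.
    + apply Rmult_lt_reg_r with (1 + Rabs u)%R; [ lra | ].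
      replace (2 / (1 + Rabs u) * Rabs u * (1 + Rabs u))%R
        with (2 * Rabs u)%R by (field; lra); lra.
    + apply Rmult_le_pos; [ apply Rdiv_le_0_compat; lra | lra ].
Qed.

(** The argument stays on the real segment between 0 and the boundary point, so differentiation,
    continuity and Abel's theorem can be taken from real power series, component by component. *)
Definition CPS (a : nat -> C) (u : R) : C :=
  (PSeries (fun k => Re (a k)) u, PSeries (fun k => Im (a k)) u).

Lemma CPS_Cser (a : nat -> C) (u : R) : CPS a u = Cser (fun n => a n * RtoC (u ^ n)).
Proof.
  unfold CPS, Cser, PSeries; f_equal; apply Series_ext; intro n;
    unfold Re, Im; simpl; ring.
Qed.

Lemma CPS_ext (a b : nat -> C) (u : R) : (forall n, a n = b n) -> CPS a u = CPS b u.
Proof. intro H; rewrite !CPS_Cser; apply Cser_ext; intro n; rewrite H; reflexivity. Qed.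

Lemma CPS_0 (a : nat -> C) : CPS a 0 = a O.
Proof. apply C_ext; simpl; apply PSeries_0. Qed.

Lemma subexp_radius (a : nat -> C) (p : C -> R) (u : R) :
  (forall z, Rabs (p z) <= Cmod z)%R -> subexp a -> (Rabs u < 1)%R ->
  Rbar_lt (Rabs u) (CV_radius (fun n => p (a n))).
Proof.
  intros Hp Ha Hu; pose proof (Rabs_pos u).
  set (r := ((1 + Rabs u) / 2)%R).
  assert (Hr : (0 < r < 1)%R) by (unfold r; lra).
  apply Rbar_lt_le_trans with (Finite r); [ simpl; unfold r; lra | ].
  apply (proj1 (CV_radius_bounded (fun n => p (a n)))).
  destruct (Ha (/ r)%R) as [M HM].
  { rewrite <- Rinv_1; apply Rinv_lt_contravar; lra. }
  exists M; intro n.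
  rewrite Rabs_mult, (Rabs_pos_eq (r ^ n)) by (apply pow_le; lra).
  apply Rle_trans with (M * (/ r) ^ n * r ^ n)%R.
  - apply Rmult_le_compat_r; [ apply pow_le; lra | ].
    eapply Rle_trans; [ apply Hp | apply HM ].
  - rewrite Rmult_assoc, <- Rpow_mult_distr, Rinv_l, pow1 by lra; lra.
Qed.

Lemma Cder_CPS (a : nat -> C) (u : R) : subexp a -> (Rabs u < 1)%R ->
  Cder (CPS a) u (CPS (fun k => RtoC (INR (S k)) * a (S k)) u).
Proof.
  intros Ha Hu; split.
  - change (is_derive (PSeries (fun k => Re (a k))) u
      (PSeries (fun k => INR (S k) * Re (a (S k)) - 0 * Im (a (S k)))%R u)).
    erewrite PSeries_ext.
    + apply is_derive_PSeries, (subexp_radius a Re); auto; apply re_le_Cmod.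
    + intro n; unfold PS_derive; ring.
  - change (is_derive (PSeries (fun k => Im (a k))) u
      (PSeries (fun k => INR (S k) * Im (a (S k)) + 0 * Re (a (S k)))%R u)).
    erewrite PSeries_ext.
    + apply is_derive_PSeries, (subexp_radius a Im); auto; apply im_le_Cmod.
    + intro n; unfold PS_derive; ring.
Qed.

Lemma Clim_CPS (a : nat -> C) (v : nat -> R) (u : R) : subexp a -> (Rabs u < 1)%R ->
  is_lim_seq v u -> Clim (fun n => CPS a (v n)) (CPS a u).
Proof.
  intros Ha Hu Hv; split; simpl.
  - apply is_lim_seq_continuous; [ | exact Hv ].
    apply PSeries_continuity, (subexp_radius a Re); auto; apply re_le_Cmod.
  - apply is_lim_seq_continuous; [ | exact Hv ].
    apply PSeries_continuity, (subexp_radius a Im); auto; apply im_le_Cmod.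
Qed.

Lemma Cser_incr_1 (a : nat -> C) : Cabs a -> Cser a = a O + Cser (fun n => a (S n)).
Proof.
  intro H; apply C_ext; simpl.
  - rewrite (Series_incr_1 (fun n => Re (a n))) by (apply Cabs_Re, H); reflexivity.
  - rewrite (Series_incr_1 (fun n => Im (a n))) by (apply Cabs_Im, H); reflexivity.
Qed.

Lemma CPS_derive_mult_var (a : nat -> C) (u : R) : subexp a -> (Rabs u < 1)%R ->
  RtoC u * CPS (fun k => RtoC (INR (S k)) * a (S k)) u = CPS (fun k => RtoC (INR k) * a k) u.
Proof.
  intros Ha Hu; rewrite !CPS_Cser.
  rewrite (Cser_incr_1 (fun n => RtoC (INR n) * a n * RtoC (u ^ n)))
    by (apply subexp_Cabs; [ apply subexp_mult; [ apply subexp_INR | ] | ]; assumption).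
  rewrite <- Cser_scal.
  - simpl (INR 0); rewrite !Cmult_0_l, Cplus_0_l.
    apply Cser_ext; intro n; simpl (u ^ S n)%R; rewrite RtoC_mult; ring.
  - apply subexp_Cabs; [ | assumption ].
    apply (subexp_shift (fun k => RtoC (INR k) * a k) 1).
    apply subexp_mult; [ apply subexp_INR | assumption ].
Qed.

Lemma CPS_plus (a b : nat -> C) (u : R) : subexp a -> subexp b -> (Rabs u < 1)%R ->
  CPS (fun k => a k + b k) u = CPS a u + CPS b u.
Proof.
  intros Ha Hb Hu; rewrite !CPS_Cser, <- Cser_plus by (apply subexp_Cabs; assumption).
  apply Cser_ext; intro n; ring.
Qed.

Lemma CPS_scal (c : C) (a : nat -> C) (u : R) : subexp a -> (Rabs u < 1)%R ->
  CPS (fun k => c * a k) u = c * CPS a u.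
Proof.
  intros Ha Hu; rewrite !CPS_Cser, <- Cser_scal by (apply subexp_Cabs; assumption).
  apply Cser_ext; intro n; ring.
Qed.

(** [Abel] describes the endpoint of the interval of convergence, so it settles radius exactly 1. A
    larger radius, as for a terminating series, is plain continuity. *)
Lemma PSeries_Abel_1 (a : nat -> R) (l : R) (v : nat -> R) :
  Rbar_le 1 (CV_radius a) -> is_series a l ->
  (forall n, v n < 1)%R -> is_lim_seq v 1 ->
  is_lim_seq (fun n => PSeries a (v n)) l.
Proof.
  intros Hr Hl Hv Hlim.
  assert (E : PSeries a 1 = l).
  { unfold PSeries; rewrite <- (is_series_unique _ _ Hl); apply Series_ext.
    intro n; rewrite pow1; ring. }
  rewrite <- E.
  destruct (Rbar_le_lt_or_eq_dec _ _ Hr) as [Hlt | Heq].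
  - apply is_lim_seq_continuous; [ | exact Hlim ].
    apply PSeries_continuity; rewrite Rabs_R1; exact Hlt.
  - pose proof (Abel a) as HA; rewrite <- Heq in HA; simpl in HA.
    eapply filterlim_comp; [ | apply HA; [ lra | exact I | ] ].
    + intros P HP; unfold filtermap; destruct HP as [e He].
      destruct (Hlim (fun y => Rabs (y - 1) < e)%R) as [N HN].
      { exists e; intros y Hy; exact Hy. }
      exists N; intros n Hn; apply He; [ apply (HN n Hn) | apply Hv ].
    + exists l; apply (is_series_ext a); [ | exact Hl ].
      intro n; rewrite pow_n_pow, pow1; unfold scal; simpl; unfold mult; simpl; ring.
Qed.

Lemma CPS_Abel_1 (a : nat -> C) (l : C) (v : nat -> R) :
  subexp a -> Clim (sum_n a) l ->
  (forall n, v n < 1)%R -> is_lim_seq v 1 -> Clim (fun n => CPS a (v n)) l.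
Proof.
  intros Ha [H1 H2] Hv Hlim.
  assert (Hr : forall p : C -> R, (forall z, Rabs (p z) <= Cmod z)%R ->
                 Rbar_le 1 (CV_radius (fun n => p (a n)))).
  { intros p Hp.
    destruct (Rbar_le_lt_dec 1 (CV_radius (fun n => p (a n)))) as [H | H]; [ exact H | ].
    (* For a radius r < 1, [subexp_radius] at u = r would yield r < r. *)
    exfalso.
    pose proof (CV_radius_ge_0 (fun n => p (a n))) as H0.
    pose proof (subexp_radius a p) as HS.
    destruct (CV_radius (fun n => p (a n))) as [r | | ]; simpl in H, H0; try easy.
    assert (Hra : (Rabs r = r)%R) by (apply Rabs_pos_eq; exact H0).
    specialize (HS r Hp Ha); rewrite Hra in HS; specialize (HS H).
    simpl in HS; lra. }
  split; simpl; apply PSeries_Abel_1; auto using re_le_Cmod, im_le_Cmod.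
  - change (is_lim_seq (sum_n (fun k => Re (a k))) (Re l)).
    eapply is_lim_seq_ext; [ intro n; apply Re_sum_n | exact H1 ].
  - change (is_lim_seq (sum_n (fun k => Im (a k))) (Im l)).
    eapply is_lim_seq_ext; [ intro n; apply Im_sum_n | exact H2 ].
Qed.


(** * Pfaff's transformation *)

(* The [u]-coefficients of (al)_j / (d)_j 2F1(al + j, ga; d + j; - u). *)
Definition theta (al ga d : C) (j k : nat) : C :=
  poch al (j + k) / poch d (j + k) * (poch ga k / RtoC (INR (fact k))) * RtoC ((-1) ^ k).

Lemma subexp_theta (al ga d : C) (j : nat) : ~ nonpos_int d -> subexp (theta al ga d j).
Proof.
  intro Hd; unfold theta; apply subexp_mult; [ apply subexp_mult | ].
  - apply (subexp_shift (fun n => poch al n / poch d n)), subexp_poch_ratio, Hd.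
  - apply subexp_poch_fact.
  - apply subexp_bounded with (K := 1%R); intro n.
    rewrite Cmod_R, pow_1_abs; lra.
Qed.

Lemma theta_coef (al ga d : C) (j k : nat) : ~ nonpos_int d ->
  (al + RtoC (INR j)) * theta al ga d j k
  + (RtoC (INR (S k)) * theta al ga d j (S k) + RtoC (INR k) * theta al ga d j k)
  = (d - ga + RtoC (INR j)) * theta al ga d (S j) k.
Proof.
  intro Hd; unfold theta.
  replace (S j + k)%nat with (S (j + k)) by lia.
  replace (j + S k)%nat with (S (j + k)) by lia.
  pose proof (poch_neq_0 d (j + k) Hd) as H1.
  pose proof (poch_neq_0 d (S (j + k)) Hd) as H2; simpl in H2.
  assert (H3 : d + RtoC (INR (j + k)) <> 0).
  { intro E; apply H2; rewrite E; ring. }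
  rewrite INR_fact_S_C, S_INR.
  pose proof (INR_S_neq_0_C k) as H4; rewrite S_INR in H4.
  pose proof (INR_fact_neq_0_C k) as H5.
  simpl poch; rewrite <- tech_pow_Rmult, RtoC_mult.
  rewrite plus_INR, ?RtoC_plus in *.
  field; auto.
Qed.

(** Write T_j for the series of [theta al ga d j] and y = u / (1 + u), so that d/dy = (1 + u)^2
    d/du. The identity says that (1 + u)^(al + j) T_j has y-derivative (d - ga + j) (1 + u)^(al + j
    + 1) T_(j+1). Hence every y-derivative of the left side of Pfaff's transformation is known in
    closed form. *)
Lemma theta_ode (al ga d : C) (j : nat) (u : R) : ~ nonpos_int d -> (Rabs u < 1)%R ->
  (al + RtoC (INR j)) * CPS (theta al ga d j) u
  + (1 + RtoC u) * CPS (fun k => RtoC (INR (S k)) * theta al ga d j (S k)) u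
  = (d - ga + RtoC (INR j)) * CPS (theta al ga d (S j)) u.
Proof.
  intros Hd Hu.
  pose proof (subexp_theta al ga d j Hd) as H1.
  pose proof (subexp_theta al ga d (S j) Hd) as H2.
  assert (H3 : subexp (fun k => RtoC (INR k) * theta al ga d j k))
    by (apply subexp_mult; [ apply subexp_INR | assumption ]).
  assert (H4 : subexp (fun k => RtoC (INR (S k)) * theta al ga d j (S k)))
    by exact (subexp_shift _ 1 H3).
  rewrite (Cmult_plus_distr_r 1), Cmult_1_l, CPS_derive_mult_var by assumption.
  rewrite <- (CPS_scal (d - ga + RtoC (INR j))), <- (CPS_scal (al + RtoC (INR j)))
    by assumption.
  rewrite <- (CPS_plus (fun k => RtoC (INR (S k)) * theta al ga d j (S k))),
    <- CPS_plus; try assumption.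
  - apply CPS_ext; intro k; apply theta_coef, Hd.
  - apply subexp_mult; [ | assumption ].
    eapply subexp_bounded; intro; apply Rle_refl.
  - intros rho Hr; destruct (H4 rho Hr) as [M HM], (H3 rho Hr) as [M' HM'].
    exists (M + M')%R; intro n; eapply Rle_trans; [ apply Cmod_triangle | ].
    specialize (HM n); specialize (HM' n); lra.
Qed.

(* In the variable [y = u / (1 + u)], [pfaff_taylor n] is the Taylor polynomial based at [u] and
   evaluated at [U] of the function (1 + u)^al 2F1(al, ga; d; - u). *)
Definition pfaff_taylor (al ga d : C) (U : R) (n : nat) (u : R) : C :=
  Cpowr (1 + u) al
  * sum_n (fun j => poch (d - ga) j / RtoC (INR (fact j)) * CPS (theta al ga d j) u
                    * RtoC (((U - u) / (1 + U)) ^ j)) n.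

(** Moving the base point of a Taylor polynomial telescopes: only the term with the derivative of
    order n + 1 survives. The distance in y from u to U is (U - u) / ((1 + U) (1 + u)), whose powers
    of 1 + u cancel those of (1 + u)^(al + j). *)
Lemma Cder_pfaff_taylor (al ga d : C) (U : R) (n : nat) (u : R) :
  ~ nonpos_int d -> (0 <= u < 1)%R -> (0 <= U)%R ->
  Cder (pfaff_taylor al ga d U n) u
    (Cpowr (1 + u) (al - 1)
     * (RtoC (INR (S n)) * (poch (d - ga) (S n) / RtoC (INR (fact (S n))))
        * CPS (theta al ga d (S n)) u * RtoC (((U - u) / (1 + U)) ^ n))).
Proof.
  intros Hd Hu HU.
  assert (Hu' : (Rabs u < 1)%R) by (rewrite Rabs_pos_eq; lra).
  assert (Dp : Cder (fun t => Cpowr (1 + t) al) u (1 * al * Cpowr (1 + u) (al - 1))).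
  { apply (Cder_Cpowr (fun t => 1 + t)%R); [ lra | auto_derive; [ exact I | ring ] ]. }
  assert (Ep : Cpowr (1 + u) al = Cpowr (1 + u) (al - 1) * (1 + RtoC u)).
  { rewrite <- RtoC_plus, Cpowr_minus, Cpowr_1 by lra; field; apply RtoC_neq_0; lra. }
  assert (Dt : forall j, Cder (CPS (theta al ga d j)) u
     (CPS (fun k => RtoC (INR (S k)) * theta al ga d j (S k)) u)).
  { intro j; apply Cder_CPS; [ apply subexp_theta, Hd | assumption ]. }
  induction n as [ | n IH ].
  - unfold pfaff_taylor.
    apply Cder_ext with (f := fun t => Cpowr (1 + t) al * CPS (theta al ga d 0) t).
    { intro t; rewrite sum_O; simpl; field. }
    pose proof (Cder_mult _ _ _ _ _ Dp (Dt O)) as D; cbv beta in D.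
    match type of D with Cder _ _ ?x => match goal with |- Cder _ _ ?y =>
      replace y with x; [ exact D | ] end end.
    pose proof (theta_ode al ga d 0 u Hd Hu') as HO.
    rewrite Ep; simpl (INR 1); simpl (fact 1); simpl poch; simpl (INR 1).
    simpl pow.
    transitivity (Cpowr (1 + u) (al - 1) *
      ((al + RtoC (INR 0)) * CPS (theta al ga d 0) u
       + (1 + RtoC u) * CPS (fun k => RtoC (INR (S k)) * theta al ga d 0 (S k)) u)).
    + simpl (INR 0); ring.
    + rewrite HO; simpl (INR 0); field.
  - set (q := fun j t => RtoC (((U - t) / (1 + U)) ^ j)).
    apply Cder_ext with (f := fun t => pfaff_taylor al ga d U n t
      + Cpowr (1 + t) al * (poch (d - ga) (S n) / RtoC (INR (fact (S n)))
                            * CPS (theta al ga d (S n)) t * q (S n) t)).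
    { intro t; unfold pfaff_taylor, q; rewrite sum_Sn; unfold plus; simpl; ring. }
    assert (Dq : Cder (q (S n)) u (RtoC (- INR (S n) / (1 + U) * ((U - u) / (1 + U)) ^ n))).
    { apply Cder_RtoC; auto_derive; [ exact I | ].
      change (match n with O => 1 | S _ => INR n + 1 end)%R with (INR (S n)).
      unfold Rminus, Rdiv; ring. }
    pose proof (Cder_plus _ _ _ _ _ IH
      (Cder_mult _ _ _ _ _ Dp
        (Cder_mult _ _ _ _ _
          (Cder_mult _ _ _ _ _ (Cder_const (poch (d - ga) (S n) / RtoC (INR (fact (S n)))) u)
             (Dt (S n))) Dq))) as D.
    match type of D with Cder _ _ ?x => match goal with |- Cder _ _ ?y =>
      replace y with x; [ exact D | ] end end.
    cbv beta.
    pose proof (theta_ode al ga d (S n) u Hd Hu') as HO.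
    set (T := CPS (theta al ga d (S n)) u) in *.
    set (T2 := CPS (theta al ga d (S (S n))) u) in *.
    set (T' := CPS (fun k => RtoC (INR (S k)) * theta al ga d (S n) (S k)) u) in *.
    set (P := Cpowr (1 + u) (al - 1)) in *.
    rewrite Ep.
    replace (q (S n) u) with (RtoC ((U - u) / (1 + U)) * q n u)
      by (unfold q; rewrite <- RtoC_mult; reflexivity).
    replace (RtoC (- INR (S n) / (1 + U) * ((U - u) / (1 + U)) ^ n))
      with (- RtoC (INR (S n)) / RtoC (1 + U) * q n u)
      by (unfold q; rewrite RtoC_mult, RtoC_div, RtoC_opp by lra; reflexivity).
    change (RtoC (((U - u) / (1 + U)) ^ n)) with (q n u).
    replace (RtoC (((U - u) / (1 + U)) ^ S n)) with (RtoC ((U - u) / (1 + U)) * q n u)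
      by (unfold q; rewrite <- RtoC_mult; reflexivity).
    assert (HU1 : RtoC (1 + U) <> 0) by (apply RtoC_neq_0; lra).
    assert (HF : RtoC (INR (fact (S n))) <> 0) by apply INR_fact_neq_0_C.
    assert (HS : RtoC (INR (S n) + 1) <> 0).
    { pose proof (INR_S_neq_0_C (S n)) as HH; rewrite S_INR in HH; exact HH. }
    rewrite (INR_fact_S_C (S n)), (S_INR (S n)).
    change (poch (d - ga) (S (S n)))
      with (poch (d - ga) (S n) * (d - ga + RtoC (INR (S n)))).
    set (b := poch (d - ga) (S n)) in *.
    set (F := RtoC (INR (fact (S n)))) in *.
    rewrite RtoC_div by lra.
    assert (Hu1 : 1 + RtoC u <> 0) by (rewrite <- RtoC_plus; apply RtoC_neq_0; lra).
    (* The differential relation eliminates the derivative series, leaving a rational identity in T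
       and T2. *)
    replace T' with (((d - ga + RtoC (INR (S n))) * T2 - (al + RtoC (INR (S n))) * T)
                     / (1 + RtoC u)).
    2: { rewrite <- HO; field; assumption. }
    rewrite ?RtoC_minus, ?RtoC_plus in *.
    field; auto.
Qed.

(** The coefficients are at most M1 rho^(j+k) M2 rho^k, so the series in k is majorized by a
    geometric one of ratio rho^2 U. The bound is uniform in u and grows only like rho^j, which is
    what the Taylor remainder can afford. *)
Lemma Cmod_theta_le (al ga d : C) (rho : R) : ~ nonpos_int d -> (1 < rho)%R ->
  exists M, (0 < M)%R /\ forall U, (rho ^ 2 * U < 1)%R ->
  forall j u, (0 <= u <= U)%R ->
  (Cmod (CPS (theta al ga d j) u) <= M / (1 - rho ^ 2 * U) * rho ^ j)%R.
Proof.
  intros Hd Hr.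
  destruct (subexp_bound_pos _ rho (subexp_poch_ratio al d Hd) Hr) as [M1 [H1 B1]].
  destruct (subexp_bound_pos _ rho (subexp_poch_fact ga) Hr) as [M2 [H2 B2]].
  exists (2 * M1 * M2)%R; split.
  { apply Rmult_lt_0_compat; [ lra | assumption ]. }
  intros U HU j u Hu.
  assert (Hg : (Rabs (rho ^ 2 * U) < 1)%R).
  { rewrite Rabs_pos_eq; [ assumption | ]. apply Rmult_le_pos; [ apply pow2_ge_0 | lra ]. }
  rewrite CPS_Cser.
  eapply Rle_trans.
  - apply Cmod_Cser_le with (b := fun k => ((M1 * M2 * rho ^ j) * (rho ^ 2 * U) ^ k)%R).
    + intro k; unfold theta; rewrite !Cmod_mult, !Cmod_R, pow_1_abs, Rmult_1_r.
      rewrite (Rabs_pos_eq (u ^ k)) by (apply pow_le; lra).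
      rewrite Rpow_mult_distr, <- pow_mult.
      replace (M1 * M2 * rho ^ j * (rho ^ (2 * k) * U ^ k))%R
        with ((M1 * rho ^ (j + k)) * (M2 * rho ^ k) * U ^ k)%R
        by (replace (2 * k)%nat with (k + k)%nat by lia; rewrite !pow_add; ring).
      apply Rmult_le_compat.
      * apply Rmult_le_pos; apply Cmod_ge_0.
      * apply pow_le; lra.
      * apply Rmult_le_compat; auto using Cmod_ge_0.
      * apply pow_incr; assumption.
    + apply (ex_series_scal_l (V := R_NormedModule)), ex_series_geom, Hg.
  - rewrite Series_scal_l, Series_geom by exact Hg.
    right; field; lra.
Qed.

Lemma pfaff (al ga d : C) (U : R) : ~ nonpos_int d -> (0 <= U < 1)%R ->
  Cpowr (1 + U) al * CPS (theta al ga d 0) U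
  = CPS (fun j => poch (d - ga) j / RtoC (INR (fact j)) * (poch al j / poch d j))
        (U / (1 + U)).
Proof.
  intros Hd HU.
  set (y := (U / (1 + U))%R).
  assert (Hy : (0 <= y < 1 / 2)%R).
  { unfold y; split.
    - apply Rdiv_le_0_compat; lra.
    - apply Rmult_lt_reg_r with (1 + U)%R; [ lra | ].
      unfold Rdiv at 1; rewrite Rmult_assoc, Rinv_l; lra. }
  (* Close enough to 1 for both demands: rho^2 U < 1 for the Gauss series, and rho^3 y < 1 for the
     remainder, the latter because rho <= 9/8 and y < 1/2. *)
  set (rho := (1 + (1 - U) / 8)%R).
  assert (Hr : (1 < rho)%R) by (unfold rho; lra).
  assert (HrU : (rho ^ 2 * U < 1)%R) by (unfold rho; nra).
  assert (Hr3 : (rho ^ 3 * y < 1)%R).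
  { assert (rho ^ 3 <= 3 / 2)%R.
    { assert (rho <= 9 / 8)%R by (unfold rho; lra).
      apply Rle_trans with ((9 / 8) ^ 3)%R; [ apply pow_incr; lra | lra ]. }
    assert (0 < rho ^ 3)%R by (apply pow_lt; lra). nra. }
  destruct (Cmod_theta_le al ga d rho Hd Hr) as [M1 [H1 B1]].
  specialize (B1 U HrU).
  destruct (subexp_bound_pos _ rho (subexp_poch_fact (d - ga)) Hr) as [M2 [H2 B2]].
  destruct (subexp_bound_pos _ rho subexp_INR Hr) as [M3 [H3 B3]].
  set (M0 := exp (ln 2 * Rabs (Re (al - 1)))).
  assert (H0 : (0 < M0)%R) by apply exp_pos.
  set (M1' := (M1 / (1 - rho ^ 2 * U))%R) in *.
  assert (H1' : (0 < M1')%R) by (apply Rdiv_lt_0_compat; lra).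
  (* In the remainder three factors grow like rho^(n+1): n + 1, (d - ga)_(n+1) / (n+1)!, and the
     Gauss series of order n + 1. Together they give rho^3 in the ratio and another rho^3 in the
     constant. *)
  set (K := (M0 * (M3 * M2 * M1') * rho ^ 3)%R).
  assert (Hdiff : forall n,
    (Cmod (pfaff_taylor al ga d U n U - pfaff_taylor al ga d U n 0)
     <= 2 * (K * (rho ^ 3 * y) ^ n) * (U - 0))%R).
  { intro n.
    apply Cmean_value_le with (df := fun u => Cpowr (1 + u) (al - 1)
     * (RtoC (INR (S n)) * (poch (d - ga) (S n) / RtoC (INR (fact (S n))))
        * CPS (theta al ga d (S n)) u * RtoC (((U - u) / (1 + U)) ^ n))); [ lra | | ].
    - intros x Hx; apply Cder_pfaff_taylor; [ assumption | lra | lra ].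
    - intros x Hx; rewrite !Cmod_mult, Cmod_Cpowr, (Cmod_R (_ ^ _)).
      replace (K * (rho ^ 3 * y) ^ n)%R with
        (M0 * ((M3 * rho ^ S n) * (M2 * rho ^ S n) * (M1' * rho ^ S n) * y ^ n))%R
        by (unfold K; rewrite !Rpow_mult_distr, <- !pow_mult;
            replace (3 * n)%nat with (n + n + n)%nat by lia;
            rewrite !pow_add; simpl; ring).
      assert (Hq : (0 <= (U - x) / (1 + U) <= y)%R).
      { unfold y, Rdiv.
        assert (0 < / (1 + U))%R by (apply Rinv_0_lt_compat; lra).
        split; [ apply Rmult_le_pos; lra | apply Rmult_le_compat_r; lra ]. }
      rewrite (Rabs_pos_eq (((U - x) / (1 + U)) ^ n)) by (apply pow_le; lra).
      repeat apply Rmult_le_compat;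
        repeat apply Rmult_le_pos; try apply Cmod_ge_0; try (left; apply exp_pos);
        try (apply pow_le; lra).
      + unfold M0.
        assert (HH : (ln (1 + x) * Re (al - 1) <= ln 2 * Rabs (Re (al - 1)))%R).
        { eapply Rle_trans; [ apply Rle_abs | rewrite Rabs_mult ].
          apply Rmult_le_compat_r; [ apply Rabs_pos | ].
          rewrite Rabs_pos_eq.
          - apply ln_le; lra.
          - rewrite <- ln_1; apply ln_le; lra. }
        destruct HH as [HH | HH]; [ left; apply exp_increasing, HH | rewrite HH; lra ].
      + apply B3.
      + apply B2.
      + apply B1; lra.
      + apply pow_incr; assumption. }
  (* Based at U the Taylor polynomial reduces to its constant term, the left side; based at 0 it is
     a partial sum of the right side. *)
  assert (EU : forall n, pfaff_taylor al ga d U n U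
                         = Cpowr (1 + U) al * CPS (theta al ga d 0) U).
  { intro n; unfold pfaff_taylor; f_equal; induction n.
    - rewrite sum_O; simpl; field.
    - rewrite sum_Sn, IHn.
      replace ((U - U) / (1 + U))%R with 0%R by (field; lra).
      rewrite pow_i by lia; unfold plus; simpl; ring. }
  set (cf := fun j => poch (d - ga) j / RtoC (INR (fact j)) * (poch al j / poch d j)).
  assert (E0 : forall n, pfaff_taylor al ga d U n 0 = sum_n (fun j => cf j * RtoC (y ^ j)) n).
  { intro n; unfold pfaff_taylor.
    replace (Cpowr (1 + 0) al) with (RtoC 1).
    2: { unfold Cpowr; rewrite Rplus_0_r, ln_1.
         replace (0 * al) with (RtoC 0) by ring; symmetry; apply Cexp_0. }
    rewrite Cmult_1_l; apply sum_n_ext; intro j.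
    rewrite CPS_0; unfold cf, theta; rewrite Nat.add_0_r; simpl fact; simpl poch.
    rewrite Rminus_0_r; fold y; simpl pow; simpl INR.
    replace (1 / 1) with (RtoC 1) by field; rewrite !Cmult_1_r; reflexivity. }
  assert (Hs : subexp cf).
  { apply subexp_mult; [ apply subexp_poch_fact | apply subexp_poch_ratio, Hd ]. }
  rewrite (CPS_Cser cf).
  assert (Hlim : Clim (sum_n (fun j => cf j * RtoC (y ^ j)))
                      (Cpowr (1 + U) al * CPS (theta al ga d 0) U)).
  { apply Clim_le_0 with (v := fun n => (2 * (K * (rho ^ 3 * y) ^ n) * (U - 0))%R).
    - intro n; rewrite <- E0, <- (EU n).
      rewrite <- Cmod_opp; eapply Rle_trans; [ right | apply (Hdiff n) ].
      f_equal; ring.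
    - apply is_lim_seq_ext with (u := fun n => ((2 * K * U) * (rho ^ 3 * y) ^ n)%R).
      { intro n; ring. }
      replace (Finite 0) with (Rbar_mult (Finite (2 * K * U)) (Finite 0))
        by (simpl; f_equal; ring).
      apply is_lim_seq_scal_l, is_lim_seq_geom.
      rewrite Rabs_pos_eq; [ assumption | ].
      apply Rmult_le_pos; [ apply pow_le; lra | lra ]. }
  apply (Clim_unique _ _ _ Hlim), Cser_lim, subexp_Cabs; [ assumption | ].
  rewrite Rabs_pos_eq; lra.
Qed.

(** Pfaff's transformation holds for u < 1. As u tends to 1 the left side is governed by Abel's
    theorem, whereas y tends to 1/2, an interior point where the right side is continuous. *)
Lemma hyp2F1_at_minus_1 (al ga d L : C) : ~ nonpos_int d ->
  Clim (sum_n (theta al ga d 0)) L ->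
  Cpowr 2 al * L
  = CPS (fun j => poch (d - ga) j / RtoC (INR (fact j)) * (poch al j / poch d j)) (1 / 2).
Proof.
  intros Hd HL.
  set (cf := fun j => poch (d - ga) j / RtoC (INR (fact j)) * (poch al j / poch d j)).
  set (v := fun n => (1 - / INR (S n))%R).
  assert (Hv : is_lim_seq v 1).
  { unfold v; replace 1%R with (1 - 0)%R by ring.
    apply is_lim_seq_minus'; [ replace (1 - 0)%R with 1%R by ring; apply is_lim_seq_const | ].
    apply (is_lim_seq_incr_1 (fun n => / INR n)%R).
    replace 0%R with (real (Rbar_inv p_infty)) by reflexivity.
    apply (is_lim_seq_inv INR p_infty); [ apply is_lim_seq_INR | discriminate ]. }
  assert (Hv1 : forall n, (0 <= v n < 1)%R).
  { intro n; unfold v; pose proof (pos_INR n); rewrite S_INR; split.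
    - assert (/ (INR n + 1) <= / 1)%R by (apply Rinv_le_contravar; lra); lra.
    - assert (0 < / (INR n + 1))%R by (apply Rinv_0_lt_compat; lra); lra. }
  apply Clim_unique with (u := fun n => Cpowr (1 + v n) al * CPS (theta al ga d 0) (v n)).
  - apply Clim_mult.
    + apply Clim_Cpowr; [ lra | ].
      replace 2%R with (1 + 1)%R by ring.
      apply is_lim_seq_plus'; [ apply is_lim_seq_const | exact Hv ].
    + apply CPS_Abel_1; auto; [ apply subexp_theta, Hd | intro n; apply Hv1 ].
  - apply Clim_ext with (u := fun n => CPS cf (v n / (1 + v n))).
    { intro n; symmetry; apply pfaff; auto. }
    apply Clim_CPS.
    + apply subexp_mult; [ apply subexp_poch_fact | apply subexp_poch_ratio, Hd ].
    + rewrite Rabs_pos_eq; lra.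
    + replace (1 / 2)%R with (1 / (1 + 1))%R by field.
      apply is_lim_seq_div'; [ exact Hv | | lra ].
      apply is_lim_seq_plus'; [ apply is_lim_seq_const | exact Hv ].
Qed.


(** * Finite differences and the Chu-Vandermonde identity *)

(* Stdlib's [Binomial.C n k] is not [0] for [k > n], hence this total variant. *)
Fixpoint binom (n k : nat) : R :=
  match n, k with
  | _, O => 1
  | O, S _ => 0
  | S n', S k' => binom n' k' + binom n' k
  end%R.

Lemma binom_gt (n k : nat) : (n < k)%nat -> binom n k = 0%R.
Proof.
  revert k; induction n; intros [ | k ] H; simpl; try lia; [ reflexivity | ].
  rewrite !IHn by lia; ring.
Qed.

Lemma binom_n_0 (n : nat) : binom n 0 = 1%R.
Proof. destruct n; reflexivity. Qed.

Lemma binom_C (n k : nat) : (k <= n)%nat -> binom n k = Binomial.C n k.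
Proof.
  revert k; induction n; intros [ | k ] H; try lia.
  - simpl; rewrite C_n_0; reflexivity.
  - simpl; rewrite C_n_0; reflexivity.
  - simpl; destruct (Nat.eq_dec k n) as [-> | Hne].
    + rewrite (binom_gt n (S n)), IHn, !C_n_n by lia; ring.
    + rewrite !IHn by lia; apply pascal; lia.
Qed.

Lemma sum_n_Sl (f : nat -> C) (n : nat) :
  sum_n f (S n) = f O + sum_n (fun k => f (S k)) n.
Proof.
  induction n.
  - rewrite sum_Sn, !sum_O; reflexivity.
  - rewrite sum_Sn, IHn, (sum_Sn _ n); unfold plus; simpl; ring.
Qed.

Lemma sum_n_rev (f : nat -> C) (n : nat) :
  sum_n f n = sum_n (fun m => f (n - m)%nat) n.
Proof.
  revert f; induction n; intro f; [ rewrite !sum_O; reflexivity | ].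
  rewrite sum_n_Sl, (IHn (fun k => f (S k))), sum_Sn, Nat.sub_diag.
  rewrite Cplus_comm; apply (f_equal2 Cplus); [ | reflexivity ].
  apply sum_n_ext_loc; intros m Hm; f_equal; lia.
Qed.

Lemma sum_n_scal_C (c : C) (f : nat -> C) (n : nat) :
  sum_n (fun k => c * f k) n = c * sum_n f n.
Proof. apply (sum_n_mult_l (K := C_Ring)). Qed.

(** If S shifts the second index, raising the first index by one acts as 1 + q S; the claim expands
    (1 + q S)^i. It serves the Chu-Vandermonde sum and both contiguity chains. *)
Lemma binomial_expansion (q : C) (X : nat -> nat -> C) (i n : nat) :
  (forall j m, X (S j) m = X j m + q * X j (S m)) ->
  X i n = sum_n (fun r => RtoC (Binomial.C i r) * q ^ r * X O (n + r)%nat) i.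
Proof.
  intro HX.
  transitivity (sum_n (fun r => RtoC (binom i r) * q ^ r * X O (n + r)%nat) i).
  2: { apply sum_n_ext_loc; intros r Hr; rewrite binom_C by assumption; reflexivity. }
  revert n; induction i; intro n.
  - rewrite sum_O; simpl; rewrite Nat.add_0_r; ring.
  - rewrite HX, !IHi, sum_n_Sl, <- sum_n_scal_C.
    transitivity (sum_n (fun r => RtoC (binom i r) * q ^ r * X O (n + r)%nat) (S i)
      + sum_n (fun r => q * (RtoC (binom i r) * q ^ r * X O (S n + r)%nat)) i).
    + rewrite sum_Sn, (binom_gt i (S i)) by lia; unfold plus; simpl; ring.
    + rewrite sum_n_Sl, !binom_n_0, <- Cplus_assoc; f_equal.
      rewrite <- (sum_n_plus (G := C_AbelianMonoid)); apply sum_n_ext; intro r.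
      change (binom (S i) (S r)) with (binom i r + binom i (S r))%R.
      replace (S n + r)%nat with (n + S r)%nat by lia.
      rewrite RtoC_plus, Cpow_S; unfold plus; simpl; ring.
Qed.

(** The array (be)_j (d - be)_m / (d)_(j+m) consists of the moments of t^j (1 - t)^m under a Beta
    law, so t = 1 - (1 - t) gives the recurrence with q = -1. *)
Lemma chu_vandermonde (be d : C) (k : nat) : ~ nonpos_int d ->
  sum_n (fun r => RtoC (Binomial.C k r) * (-1) ^ r * (poch (d - be) r / poch d r)) k
  = poch be k / poch d k.
Proof.
  intro Hd.
  pose proof (binomial_expansion (-1)
    (fun j m => poch be j * poch (d - be) m / poch d (j + m)) k 0) as H.
  cbv beta in H; rewrite Nat.add_0_r in H.
  transitivity (poch be k * poch (d - be) 0 / poch d k).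
  - rewrite H.
    + apply sum_n_ext; intro r; simpl; unfold Cdiv; ring.
    + intros j m; replace (S j + m)%nat with (S (j + m)) by lia.
      replace (j + S m)%nat with (S (j + m)) by lia.
      pose proof (poch_neq_0 d (S (j + m)) Hd) as Hp; simpl in Hp.
      simpl poch; rewrite plus_INR, RtoC_plus in *; field; split.
      * intro E; apply Hp; rewrite E; ring.
      * apply poch_neq_0, Hd.
  - simpl; unfold Cdiv; ring.
Qed.

(** No parameter is attached to the x index alone. After reversal the sum runs over the y index with
    alternating binomial weights, and its value (be)_k / (d)_k cancels the denominator (be)_k common
    to the whole degree; [c] collects all that depends on k only. *)
Lemma kdf_degree_sum (al ga be d b : C) (k : nat) :
  b = d - be -> ~ nonpos_int be -> ~ nonpos_int d ->
  sum_n (fun m => kdf_term [al; ga] [] [b] [be] [] [d] (RtoC (-1)) 1 m (k - m)) k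
  = theta al ga d 0 k.
Proof.
  intros -> Hbe Hd.
  set (c := poch al k * poch ga k / poch be k * (-1) ^ k / RtoC (INR (fact k))).
  pose proof (poch_neq_0 be k Hbe) as H1.
  pose proof (poch_neq_0 d k Hd) as H2.
  pose proof (INR_fact_neq_0_C k) as H3.
  transitivity (c * (poch be k / poch d k)).
  - rewrite <- chu_vandermonde, sum_n_rev, <- sum_n_scal_C by assumption.
    apply sum_n_ext_loc; intros m Hm; unfold kdf_term, poch_prod, c; simpl fold_right.
    replace (k - (k - m))%nat with m by lia.
    replace (k - m + m)%nat with k by lia.
    unfold Binomial.C.
    rewrite RtoC_div, RtoC_mult
      by (apply Rmult_integral_contrapositive; split; apply INR_fact_neq_0).
    rewrite Cpow_1_l.
    pose proof (poch_neq_0 d m Hd) as H4.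
    pose proof (INR_fact_neq_0_C m) as H5.
    pose proof (INR_fact_neq_0_C (k - m)) as H6.
    assert (E : (-1) ^ (k - m) = (-1) ^ k * (-1) ^ m).
    { replace k with (m + (k - m))%nat at 2 by lia.
      rewrite Cpow_add_r, (Cmult_comm ((-1) ^ m)), <- Cmult_assoc, <- Cpow_mult_l.
      replace (-1 * -1) with (RtoC 1) by ring; rewrite Cpow_1_l; ring. }
    rewrite E; match goal with |- ?x = ?y => change (@eq C x y) end; field; auto.
  - change (@eq C (c * (poch be k / poch d k)) (theta al ga d 0 k)).
    unfold c, theta; simpl (0 + k)%nat; rewrite RtoC_pow; field; auto.
Qed.

Lemma kdf_sum_theta (al ga be d b L : C) :
  b = d - be -> ~ nonpos_int be -> ~ nonpos_int d ->
  kdf_sum [al; ga] [] [b] [be] [] [d] (RtoC (-1)) 1 L ->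
  Clim (sum_n (theta al ga d 0)) L.
Proof.
  intros Hb Hbe Hd H; apply filterlim_Clim in H.
  revert H; apply Clim_ext; intro N; unfold kdf_partial.
  apply sum_n_ext; intro k; apply kdf_degree_sum; assumption.
Qed.


(** * Regularized Gauss series at one half *)

(* Dividing 2F1(a, b; d; x) by Gamma(d) makes the contiguity relations hold for every [d],
   including the non-positive integers. *)
Definition hypreg_coef (a b d : C) (k : nat) : C :=
  poch a k / RtoC (INR (fact k)) * (poch b k * rGamma (d + RtoC (INR k))).

Definition hypreg (a b d : C) : C := CPS (hypreg_coef a b d) (1 / 2).

Lemma rGamma_INR_step (d : C) (k : nat) :
  rGamma (d + RtoC (INR k))
  = (d + RtoC (INR k)) * rGamma (d + RtoC (INR (S k))).
Proof. rewrite rGamma_step, S_INR, RtoC_plus, Cplus_assoc; reflexivity. Qed.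

Lemma subexp_poch_rGamma (b d : C) :
  subexp (fun k => poch b k * rGamma (d + RtoC (INR k))).
Proof.
  apply (subexp_linear_ratio b d); intro n.
  rewrite (rGamma_INR_step d n); simpl poch; ring.
Qed.

Lemma subexp_hypreg_coef (a b d : C) : subexp (hypreg_coef a b d).
Proof. apply subexp_mult; [ apply subexp_poch_fact | apply subexp_poch_rGamma ]. Qed.

Lemma Rabs_half_lt_1 : (Rabs (1 / 2) < 1)%R.
Proof. rewrite Rabs_pos_eq; lra. Qed.

Lemma Cabs_half (a : nat -> C) : subexp a -> Cabs (fun k => a k * RtoC ((1 / 2) ^ k)).
Proof. intro H; apply subexp_Cabs; [ exact H | apply Rabs_half_lt_1 ]. Qed.

Lemma Cabs_Clim_0 (a : nat -> C) : Cabs a -> Clim a 0.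
Proof.
  intro H; apply Clim_Cmod_0.
  apply is_lim_seq_ext with (u := fun n => Cmod (a n)).
  - intro n; f_equal; ring.
  - apply (ex_series_lim_0 (fun n => Cmod (a n))), H.
Qed.

Lemma subexp_affine (c : C) : subexp (fun k => c + RtoC (INR k)).
Proof.
  intros rho Hr; destruct (subexp_INR rho Hr) as [M HM].
  exists (Cmod c + M)%R; intro n.
  eapply Rle_trans; [ apply Cmod_triangle | ].
  specialize (HM n).
  assert (1 <= rho ^ n)%R by (apply pow_R1_Rle; lra).
  pose proof (Cmod_ge_0 c); nra.
Qed.

Lemma subexp_const (c : C) : subexp (fun _ => c).
Proof. apply subexp_bounded with (K := Cmod c); intro n; apply Rle_refl. Qed.

Lemma pow_half_S_C (k : nat) : RtoC ((1 / 2) ^ S k) = RtoC ((1 / 2) ^ k) / 2.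
Proof. simpl pow; rewrite RtoC_mult, RtoC_div by lra; field. Qed.

(** True term by term: (d - 1 + k) - (d - a) = a - 1 + k, and (a - 1)_k (a - 1 + k) = (a - 1)
    (a)_k. *)
Lemma hypreg_contiguous_top (a b d : C) :
  (a - 1) * hypreg a b d = hypreg (a - 1) b (d - 1) - (d - a) * hypreg (a - 1) b d.
Proof.
  unfold hypreg; rewrite !CPS_Cser.
  pose proof (fun a b d => Cabs_half _ (subexp_hypreg_coef a b d)) as HC.
  match goal with |- _ = ?x - ?c * ?y => replace (x - c * y) with (x + (- c) * y) by ring end.
  rewrite <- !Cser_scal, <- Cser_plus by (try apply Cabs_scal; apply HC).
  apply Cser_ext; intro k; unfold hypreg_coef.
  replace (d - 1 + RtoC (INR k)) with (d + RtoC (INR k) - 1) by ring.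
  rewrite (rGamma_step (d + RtoC (INR k) - 1)).
  replace (d + RtoC (INR k) - 1 + 1) with (d + RtoC (INR k)) by ring.
  assert (E : (a - 1) * poch a k = poch (a - 1) k * (a - 1 + RtoC (INR k))).
  { pose proof (poch_S_l (a - 1) k) as H.
    replace (a - 1 + 1) with a in H by ring; rewrite <- H; reflexivity. }
  transitivity ((a - 1) * poch a k / RtoC (INR (fact k))
    * (poch b k * rGamma (d + RtoC (INR k))) * RtoC ((1 / 2) ^ k)).
  - unfold Cdiv; ring.
  - rewrite E; unfold Cdiv; ring.
Qed.

(** Here the terms do not match one by one; their defect is a difference G k - G (k + 1), where the
    argument 1/2 enters through the ratio of consecutive powers. *)
Lemma hypreg_contiguous_half (a b d : C) :
  hypreg a b d + (d - a) * hypreg a b (d + 1) = 2 * hypreg a (b - 1) d.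
Proof.
  pose proof (fun a b d => Cabs_half _ (subexp_hypreg_coef a b d)) as HC.
  (* At index k the certificate is (a)_k (b)_(k-1) / ((k-1)! Gamma(d + k)) times 2^(1-k), hence the
     definition by cases with value 0 at k = 0. *)
  set (G := fun k => match k with O => RtoC 0 | S k =>
    ((a + RtoC (INR k)) * hypreg_coef a b (d + 1) k) * RtoC ((1 / 2) ^ k) end).
  assert (H : Cser (fun k => (hypreg_coef a b d k * RtoC ((1 / 2) ^ k)
      + (d - a) * (hypreg_coef a b (d + 1) k * RtoC ((1 / 2) ^ k)))
      + (-2) * (hypreg_coef a (b - 1) d k * RtoC ((1 / 2) ^ k))) = G O).
  { apply Cser_telescope.
    - repeat (apply Cabs_plus || apply Cabs_scal); apply HC.
    - intros [ | k ]; unfold G, hypreg_coef.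
      + rewrite (rGamma_INR_step d 0); simpl.
        replace (d + 1 + 0) with (d + 1) by ring; field.
      + rewrite (rGamma_INR_step d (S k)).
        replace (d + 1 + RtoC (INR (S k))) with (d + RtoC (INR (S (S k))))
          by (rewrite !S_INR, !RtoC_plus; ring).
        replace (d + 1 + RtoC (INR k)) with (d + RtoC (INR (S k)))
          by (rewrite !S_INR, !RtoC_plus; ring).
        rewrite (rGamma_INR_step d (S k)).
        rewrite (poch_S_l (b - 1) k); replace (b - 1 + 1) with b by ring.
        simpl poch; rewrite INR_fact_S_C, pow_half_S_C.
        pose proof (INR_S_neq_0_C k) as H4.
        pose proof (INR_fact_neq_0_C k) as H5.
        rewrite S_INR, RtoC_plus in *; field; auto.
    - assert (HG : Clim (fun k => G (S k)) 0).
      { apply Cabs_Clim_0, (Cabs_half (fun k => (a + RtoC (INR k)) * hypreg_coef a b (d + 1) k)).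
        apply subexp_mult; [ apply subexp_affine | apply subexp_hypreg_coef ]. }
      destruct HG as [H1 H2]; split.
      + apply is_lim_seq_incr_1; exact H1.
      + apply is_lim_seq_incr_1; exact H2. }
  rewrite !Cser_plus, !Cser_scal in H
    by (repeat (apply Cabs_plus || apply Cabs_scal); apply HC).
  unfold hypreg; rewrite !CPS_Cser.
  set (x := Cser (fun k => hypreg_coef a (b - 1) d k * RtoC ((1 / 2) ^ k))) in *.
  replace (2 * x) with (0 + 2 * x) by ring.
  change (G O) with (RtoC 0) in H; rewrite <- H; ring.
Qed.

(** For numerator parameters with sum 1 the recurrence in d, with step 2, has order one. The
    telescoping rests on (d + k)(d + 1 + k) - (d + a)(d + 1 - a) = 2k (d + 1 + k) - (a + k)(1 - a +
    k). *)
Lemma hypreg_complementary_step (a d : C) :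
  hypreg a (1 - a) d = (d + a) * (d + 1 - a) * hypreg a (1 - a) (d + 2).
Proof.
  pose proof (fun a b d => Cabs_half _ (subexp_hypreg_coef a b d)) as HC.
  set (G := fun k => (2 * RtoC (INR k) * (d + 1 + RtoC (INR k))
                      * hypreg_coef a (1 - a) (d + 2) k) * RtoC ((1 / 2) ^ k)).
  assert (H : Cser (fun k => hypreg_coef a (1 - a) d k * RtoC ((1 / 2) ^ k)
      + - ((d + a) * (d + 1 - a)) * (hypreg_coef a (1 - a) (d + 2) k * RtoC ((1 / 2) ^ k)))
      = G O).
  { apply Cser_telescope.
    - repeat (apply Cabs_plus || apply Cabs_scal); apply HC.
    - intro k; unfold G, hypreg_coef.
      rewrite (rGamma_INR_step d k), (rGamma_INR_step d (S k)).
      replace (d + RtoC (INR (S (S k)))) with (d + 2 + RtoC (INR k))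
        by (rewrite !S_INR, !RtoC_plus; ring).
      rewrite (rGamma_INR_step (d + 2) k).
      simpl poch; rewrite INR_fact_S_C, pow_half_S_C.
      pose proof (INR_S_neq_0_C k) as H4.
      pose proof (INR_fact_neq_0_C k) as H5.
      rewrite S_INR, RtoC_plus in *; field; auto.
    - apply Cabs_Clim_0, Cabs_half.
      apply subexp_mult; [ | apply subexp_hypreg_coef ].
      apply subexp_mult; [ | apply subexp_affine ].
      apply subexp_mult; [ apply subexp_const | apply subexp_INR ]. }
  rewrite Cser_plus, Cser_scal in H by (try apply Cabs_scal; apply HC).
  unfold hypreg; rewrite !CPS_Cser.
  replace (G O) with (RtoC 0) in H by (unfold G; simpl; ring).
  match goal with |- ?x = ?y => replace y with (0 + y) by ring; rewrite <- H; ring end.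
Qed.

(** * Large denominator parameter and Bailey's theorem *)

Lemma Cmod_poch_S_ge (z : C) (x : R) (k : nat) :
  (0 <= x <= Re z)%R -> (x * INR (fact k) <= Cmod (poch z (S k)))%R.
Proof.
  intro Hx.
  assert (Hz : forall j, (Re z + INR j <= Cmod (z + RtoC (INR j)))%R).
  { intro j; eapply Rle_trans; [ | apply re_le_Cmod ]; apply Rle_abs. }
  induction k.
  - simpl poch; rewrite Cmult_1_l.
    specialize (Hz O); simpl in Hz; simpl; lra.
  - change (poch z (S (S k))) with (poch z (S k) * (z + RtoC (INR (S k)))).
    rewrite Cmod_mult; change (fact (S k)) with (S k * fact k)%nat; rewrite mult_INR.
    replace (x * (INR (S k) * INR (fact k)))%R with (x * INR (fact k) * INR (S k))%R by ring.
    pose proof (pos_INR (fact k)); pose proof (pos_INR (S k)).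
    apply Rmult_le_compat; [ apply Rmult_le_pos; lra | lra | exact IHk | ].
    specialize (Hz (S k)); lra.
Qed.

Lemma not_nonpos_int_Re (z : C) : (0 < Re z)%R -> ~ nonpos_int z.
Proof. intros Hz [k ->]; simpl in Hz; pose proof (pos_INR k); lra. Qed.

(** [F M] is 2F1(a, b; d + M; 1/2). Every term after the first carries a factor 1/M against a
    summable majorant independent of M, so the sum tends to 1. *)
Lemma hypreg_large_parameter (a b d : C) : (0 < Re d)%R ->
  exists F : nat -> C, Clim F 1 /\
  forall M, hypreg a b (d + RtoC (INR M)) = rGamma (d + RtoC (INR M)) * F M.
Proof.
  intro Hd.
  set (f := fun M k => poch a k / RtoC (INR (fact k)) * (poch b k / poch (d + RtoC (INR M)) k)
                       * RtoC ((1 / 2) ^ k)).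
  assert (HM : forall M, (INR M <= Re (d + RtoC (INR M)))%R) 
    by (intro M; unfold Re in *; simpl; lra).
  assert (Hn : forall M, ~ nonpos_int (d + RtoC (INR M))).
  { intro M; apply not_nonpos_int_Re; pose proof (pos_INR M); specialize (HM M).
    unfold Re in *; simpl in *; lra. }
  assert (Hf : forall M, Cabs (f M)).
  { intro M; apply Cabs_half.
    apply subexp_mult; [ apply subexp_poch_fact | apply subexp_poch_ratio, Hn ]. }
  exists (fun M => Cser (f M)); split.
  (* The factor k compensates the bound |(d + M)_k| >= M (k - 1)! = M k! / k. *)
  - set (e0 := fun k => poch a k / RtoC (INR (fact k)) * (poch b k / RtoC (INR (fact k)))
                       * RtoC (INR k)).
    set (e := fun k => e0 (S k) * RtoC ((1 / 2) ^ S k)).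
    assert (He : ex_series (fun k => Cmod (e k))).
    { apply (ex_series_incr_1 (fun k => Cmod (e0 k * RtoC ((1 / 2) ^ k)))), Cabs_half.
      apply subexp_mult; [ apply subexp_mult; apply subexp_poch_fact | apply subexp_INR ]. }
    assert (Hb : forall M, (1 <= M)%nat ->
      (Cmod (Cser (f M) - 1) <= 2 * (/ INR M * Series (fun k => Cmod (e k))))%R).
    { intros M HM1.
      assert (HMp : (0 < INR M)%R) by (apply INR_gt_0; assumption).
      replace (Cser (f M) - 1) with (Cser (fun k => f M (S k))).
      2: { rewrite (Cser_incr_1 (f M)) by apply Hf.
           replace (f M O) with (RtoC 1); [ ring | unfold f; simpl; field ]. }
      rewrite <- Series_scal_l; apply Cmod_Cser_le.
      - intro k; unfold f, e, e0; rewrite !Cmod_mult.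
        rewrite <- !Rmult_assoc; apply Rmult_le_compat_r; [ apply Cmod_ge_0 | ].
        match goal with |- (_ <= / INR M * ?x * ?z * ?w)%R =>
          replace (/ INR M * x * z * w)%R with (x * (z * (w * / INR M)))%R by ring end.
        apply Rmult_le_compat_l; [ apply Cmod_ge_0 | ].
        rewrite !Cmod_div, !Cmod_R by (apply poch_neq_0, Hn || apply INR_fact_neq_0_C).
        unfold Rdiv; rewrite !Rmult_assoc.
        apply Rmult_le_compat_l; [ apply Cmod_ge_0 | ].
        pose proof (Cmod_poch_S_ge (d + RtoC (INR M)) (INR M) k) as HP.
        assert (HF : (0 < INR (fact k))%R) by apply INR_fact_lt_0.
        assert (HS : (0 < INR (S k))%R) by (apply INR_gt_0; lia).
        rewrite !Rabs_pos_eq by (apply pos_INR).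
        change (fact (S k)) with (S k * fact k)%nat; rewrite mult_INR.
        replace (/ (INR (S k) * INR (fact k)) * (INR (S k) * / INR M))%R
          with (/ (INR M * INR (fact k)))%R by (field; lra).
        apply Rinv_le_contravar; [ apply Rmult_lt_0_compat; assumption | ].
        apply HP; split; [ apply pos_INR | apply HM ].
      - apply (ex_series_scal_l (V := R_NormedModule)), He. }
    apply Clim_Cmod_0, is_lim_seq_incr_1.
    apply is_lim_seq_le_le with (u := fun _ => 0%R)
      (w := fun n => (2 * Series (fun k => Cmod (e k)) * / INR (S n))%R).
    + intro n; split; [ apply Cmod_ge_0 | ].
      eapply Rle_trans; [ apply Hb; lia | lra ].
    + apply is_lim_seq_const.
    + replace (Finite 0)
        with (Rbar_mult (Finite (2 * Series (fun k => Cmod (e k)))) (Finite 0))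
        by (simpl; f_equal; ring).
      apply is_lim_seq_scal_l, (is_lim_seq_incr_1 (fun n => / INR n)%R).
      replace (Finite 0) with (Rbar_inv p_infty) by reflexivity.
      apply (is_lim_seq_inv INR p_infty); [ apply is_lim_seq_INR | discriminate ].
  - intro M; unfold hypreg; rewrite CPS_Cser, <- Cser_scal by apply Hf.
    apply Cser_ext; intro k; unfold hypreg_coef, f.
    rewrite (rGamma_poch (d + RtoC (INR M)) k).
    field; split; [ apply poch_neq_0, Hn | apply INR_fact_neq_0_C ].
Qed.

Lemma poch_ratio_rgauss (z w : C) (n : nat) : ~ nonpos_int z ->
  poch w (S n) / poch z (S n) = rgauss_seq w n / rgauss_seq z n * Cpowr (INR n) (w - z).
Proof.
  intro Hz; unfold rgauss_seq; rewrite Cpowr_minus.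
  pose proof (poch_neq_0 z (S n) Hz); pose proof (INR_fact_neq_0_C n).
  pose proof (Cpowr_neq_0 (INR n) w); pose proof (Cpowr_neq_0 (INR n) z).
  field; auto.
Qed.

(** Source of the constant 2^(-a): one Pochhammer ratio has length about n, the other about 2n. *)
Lemma Clim_half_powers (a : C) :
  Clim (fun n => Cpowr (INR n) a * Cpowr (INR (S (2 * n))) (- a)) (Cpowr 2 (- a)).
Proof.
  apply Clim_ext_loc with (u := fun n => Cpowr (INR (S (2 * n)) / INR n) (- a)).
  - exists 1%nat; intros n Hn.
    assert (H1 : (0 < INR n)%R) by (apply INR_gt_0; assumption).
    assert (H2 : (0 < INR (S (2 * n)))%R) by (apply INR_gt_0; lia).
    replace (Cpowr (INR (S (2 * n))) (- a))
      with (Cpowr (INR (S (2 * n)) / INR n * INR n) (- a))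
      by (f_equal; field; lra).
    rewrite Cpowr_base_mult, (Cpowr_opp (INR n)).
    + field; apply Cpowr_neq_0.
    + apply Rdiv_lt_0_compat; assumption.
    + assumption.
  - apply Clim_Cpowr; [ lra | ].
    apply is_lim_seq_ext_loc with (u := fun n => (2 + / INR n)%R).
    + exists 1%nat; intros n Hn.
      assert (H1 : (0 < INR n)%R) by (apply INR_gt_0; assumption).
      rewrite S_INR, mult_INR; simpl (INR 2); field; lra.
    + replace (Finite 2) with (Finite (2 + 0)) by (f_equal; ring).
      apply is_lim_seq_plus'; [ apply is_lim_seq_const | ].
      replace (Finite 0) with (Rbar_inv p_infty) by reflexivity.
      apply (is_lim_seq_inv INR p_infty); [ apply is_lim_seq_INR | discriminate ].
Qed.

Lemma INR_double_C (n : nat) : RtoC (INR (2 * n)) = 2 * RtoC (INR n).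
Proof. rewrite mult_INR, RtoC_mult; reflexivity. Qed.

(** The recurrence supplies only the factors d - a + 1, d - a + 3, ... Stepping
    [rGamma ((d - a) / 2)] contributes the missing (d - a) / 2 + j, and with the 2 taken from d + a
    + 2j the whole becomes (d - a)_(2n). This replaces the duplication formula. *)
Lemma bailey_iterate (a d : C) (n : nat) :
  hypreg a (1 - a) d * rGamma ((d - a) / 2)
  = poch ((d + a) / 2) n * poch (d - a) (2 * n)
    * hypreg a (1 - a) (d + RtoC (INR (2 * n))) * rGamma ((d - a) / 2 + RtoC (INR n)).
Proof.
  induction n.
  - simpl; replace (d + 0) with d by ring.
    replace ((d - a) / 2 + 0) with ((d - a) / 2) by ring; ring.
  - rewrite IHn, (hypreg_complementary_step a (d + RtoC (INR (2 * n)))).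
    rewrite (rGamma_INR_step ((d - a) / 2) n).
    replace (2 * S n)%nat with (S (S (2 * n))) by lia.
    assert (HS : forall z m, poch z (S m) = poch z m * (z + RtoC (INR m))) by reflexivity.
    rewrite !HS.
    replace (d + RtoC (INR (2 * n)) + 2) with (d + RtoC (INR (S (S (2 * n)))))
      by (rewrite !S_INR, !RtoC_plus; ring).
    rewrite (S_INR (2 * n)), RtoC_plus, INR_double_C; field.
Qed.

Lemma bailey_Re_pos (a d : C) :
  (0 < Re d)%R -> (0 < Re (d - a))%R ->
  hypreg a (1 - a) d * rGamma ((d - a) / 2)
  = Cpowr 2 (- a) * rGamma (d - a) * rGamma ((d + a) / 2).
Proof.
  intros Hd Hm.
  assert (Hm2 : (0 < Re ((d - a) / 2))%R).
  { replace ((d - a) / 2) with (RtoC (1 / 2) * (d - a)) by (rewrite RtoC_div by lra; field).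
    unfold Re in *; simpl in *; lra. }
  pose proof (not_nonpos_int_Re _ Hd) as Nd.
  pose proof (not_nonpos_int_Re _ Hm2) as Nm2.
  destruct (rGamma_CGamma _ Nd) as [Gd _].
  destruct (rGamma_CGamma _ Nm2) as [Gm2 _].
  destruct (hypreg_large_parameter a (1 - a) d Hd) as [F [HF EF]].
  assert (Hphi : forall c, filterlim (fun n => (2 * n + c)%nat) eventually eventually).
  { intro c; apply eventually_subseq; intro n; lia. }
  (* The sequence is constant in n. Pochhammer symbols of lengths n + 1 and 2n + 2 belong to Gauss
     sequences of indices n and 2n + 1, which leaves the powers n^a and (2n + 1)^(-a). *)
  apply Clim_unique with (u := fun n =>
    rGamma d * rGamma ((d - a) / 2) * F (2 * n + 2)%nat
    * ((rgauss_seq ((d + a) / 2) n / rgauss_seq ((d - a) / 2) n)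
       * (rgauss_seq (d - a) (2 * n + 1) / rgauss_seq d (2 * n + 1))
       * (Cpowr (INR n) a * Cpowr (INR (S (2 * n))) (- a)))).
  - apply Clim_ext with (u := fun _ => hypreg a (1 - a) d * rGamma ((d - a) / 2));
      [ | apply Clim_const ].
    intro n; rewrite (bailey_iterate a d (S n)), EF.
    replace (2 * n + 2)%nat with (2 * S n)%nat by lia.
    replace (2 * n + 1)%nat with (S (2 * n)) by lia.
    rewrite (rGamma_poch d (2 * S n)), (rGamma_poch ((d - a) / 2) (S n)).
    transitivity (poch ((d + a) / 2) (S n) / poch ((d - a) / 2) (S n)
      * (poch (d - a) (2 * S n) / poch d (2 * S n))
      * (poch d (2 * S n) * rGamma (d + RtoC (INR (2 * S n)))
         * (poch ((d - a) / 2) (S n) * rGamma ((d - a) / 2 + RtoC (INR (S n))))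
         * F (2 * S n)%nat)).
    { field; split; apply poch_neq_0; assumption. }
    rewrite (poch_ratio_rgauss _ _ n Nm2).
    replace (2 * S n)%nat with (S (S (2 * n))) by lia.
    rewrite (poch_ratio_rgauss _ _ (S (2 * n)) Nd).
    replace ((d + a) / 2 - (d - a) / 2) with a by field.
    replace (d - a - d) with (- a) by ring.
    ring.
  - replace (Cpowr 2 (- a) * rGamma (d - a) * rGamma ((d + a) / 2))
      with (rGamma d * rGamma ((d - a) / 2) * 1
        * ((rGamma ((d + a) / 2) / rGamma ((d - a) / 2)) * (rGamma (d - a) / rGamma d)
           * Cpowr 2 (- a))) by (field; auto).
    repeat apply Clim_mult; try apply Clim_const.
    + apply (Clim_subseq F 1 (fun n => (2 * n + 2)%nat)); auto.
    + apply rGamma_lim.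
    + apply Clim_inv; [ assumption | apply rGamma_lim ].
    + apply (Clim_subseq (rgauss_seq (d - a)) _ (fun n => (2 * n + 1)%nat)); auto.
      apply rGamma_lim.
    + apply (Clim_inv (fun n => rgauss_seq d (2 * n + 1))); [ assumption | ].
      apply (Clim_subseq (rgauss_seq d) _ (fun n => (2 * n + 1)%nat)); auto.
      apply rGamma_lim.
    + apply Clim_half_powers.
Qed.

(** Both sides acquire the same Pochhammer factors when d is replaced by d + 2n, which reduces the
    claim to the right half-plane. *)
Lemma bailey (a d : C) :
  hypreg a (1 - a) d * rGamma ((d - a) / 2)
  = Cpowr 2 (- a) * rGamma (d - a) * rGamma ((d + a) / 2).
Proof.
  destruct (exists_INR_ge (1 + Rabs (Re d) + Rabs (Re (d - a)))) as [n Hn].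
  specialize (Hn n (Nat.le_refl n)).
  assert (Hn2 : (INR n <= INR (2 * n))%R) by (apply le_INR; lia).
  rewrite (bailey_iterate a d n).
  pose proof (bailey_Re_pos a (d + RtoC (INR (2 * n)))) as H.
  assert (H1 : (- Rabs (Re d) <= Re d)%R) by (unfold Rabs; destruct Rcase_abs; lra).
  assert (H2 : (- Rabs (Re (d - a)) <= Re (d - a))%R) by (unfold Rabs; destruct Rcase_abs; lra).
  assert (H3 : (0 <= Rabs (Re d) /\ 0 <= Rabs (Re (d - a)))%R) by (split; apply Rabs_pos).
  replace ((d - a) / 2 + RtoC (INR n)) with ((d + RtoC (INR (2 * n)) - a) / 2)
    by (rewrite INR_double_C; field).
  rewrite <- Cmult_assoc, H.
  - rewrite (rGamma_poch (d - a) (2 * n)), (rGamma_poch ((d + a) / 2) n).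
    replace ((d + a) / 2 + RtoC (INR n)) with ((d + RtoC (INR (2 * n)) + a) / 2)
      by (rewrite INR_double_C; field).
    replace (d + RtoC (INR (2 * n)) - a) with (d - a + RtoC (INR (2 * n))) by ring.
    ring.
  - change (Re (d + RtoC (INR (2 * n)))) with (Re d + INR (2 * n))%R; lra.
  - replace (d + RtoC (INR (2 * n)) - a) with (d - a + RtoC (INR (2 * n))) by ring.
    change (Re (d - a + RtoC (INR (2 * n)))) with (Re (d - a) + INR (2 * n))%R; lra.
Qed.


(** * Generalized Kummer summation *)

Lemma not_nonpos_int_plus_INR (z : C) (n : nat) :
  ~ nonpos_int z -> ~ nonpos_int (z + RtoC (INR n)).
Proof.
  intros Hz [k Hk]; apply Hz; exists (k + n)%nat.
  replace z with (z + RtoC (INR n) - RtoC (INR n)) by ring.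
  rewrite Hk, plus_INR, !RtoC_opp, RtoC_plus; ring.
Qed.

Lemma not_nonpos_int_half (z : C) : ~ nonpos_int z -> ~ nonpos_int (z / 2).
Proof.
  intros Hz [k Hk]; apply Hz; exists (2 * k)%nat.
  replace z with (2 * (z / 2)) by field.
  rewrite Hk, !RtoC_opp, INR_double_C; ring.
Qed.

Lemma rGamma_neq_0 (z : C) : ~ nonpos_int z -> rGamma z <> 0.
Proof. intro H; apply (rGamma_CGamma z H). Qed.

Lemma CGamma_rGamma (z : C) : ~ nonpos_int z -> CGamma z = / rGamma z.
Proof. intro H; apply (rGamma_CGamma z H). Qed.

Lemma bailey_quotient (a d : C) (r : nat) : ~ nonpos_int (d - a) ->
  hypreg a (1 - a) (d + RtoC (INR r)) / rGamma (d - a + RtoC (INR r))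
  = Cpowr 2 (- a) * (rGamma ((d + a + RtoC (INR r)) / 2) / rGamma ((d - a + RtoC (INR r)) / 2)).
Proof.
  intro H.
  pose proof (bailey a (d + RtoC (INR r))) as HB.
  replace (d + RtoC (INR r) - a) with (d - a + RtoC (INR r)) in HB by ring.
  replace (d + RtoC (INR r) + a) with (d + a + RtoC (INR r)) in HB by ring.
  pose proof (not_nonpos_int_plus_INR _ r H) as H1.
  pose proof (rGamma_neq_0 _ H1) as H2.
  pose proof (rGamma_neq_0 _ (not_nonpos_int_half _ H1)) as H3.
  transitivity (hypreg a (1 - a) (d + RtoC (INR r)) * rGamma ((d - a + RtoC (INR r)) / 2)
    / rGamma ((d - a + RtoC (INR r)) / 2) / rGamma (d - a + RtoC (INR r))).
  - field; auto.
  - rewrite HB; field; auto.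
Qed.

(** Dividing by [rGamma (d - a + n)] absorbs the coefficient d - a + n of the contiguity relation,
    and 2^j absorbs its factor 2. What remains is the recurrence of [binomial_expansion] with q =
    1. *)
Lemma hypreg_lowered (a d : C) (i : nat) : ~ nonpos_int (d - a) ->
  2 ^ i * hypreg a (1 - a - RtoC (INR i)) d / rGamma (d - a)
  = Cpowr 2 (- a) * sum_n (fun r => RtoC (Binomial.C i r)
      * (rGamma ((d + a + RtoC (INR r)) / 2) / rGamma ((d - a + RtoC (INR r)) / 2))) i.
Proof.
  intro H.
  pose proof (binomial_expansion 1 (fun j n =>
    2 ^ j * hypreg a (1 - a - RtoC (INR j)) (d + RtoC (INR n)) / rGamma (d - a + RtoC (INR n)))
    i 0) as HX.
  cbv beta in HX; simpl (INR 0) in HX.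
  replace (d + 0) with d in HX by ring; replace (d - a + 0) with (d - a) in HX by ring.
  rewrite HX; clear HX.
  - rewrite <- sum_n_scal_C; apply sum_n_ext; intro r.
    rewrite Cpow_1_l; simpl (0 + r)%nat; simpl (2 ^ 0).
    replace (1 - a - 0) with (1 - a) by ring.
    rewrite Cmult_1_l, bailey_quotient by assumption.
    match goal with |- ?x = ?y => change (@eq C x y) end; ring.
  - intros j n.
    pose proof (rGamma_neq_0 _ (not_nonpos_int_plus_INR _ (S n) H)) as H1.
    pose proof (rGamma_neq_0 _ (not_nonpos_int_plus_INR _ n H)) as H2.
    pose proof (hypreg_contiguous_half a (1 - a - RtoC (INR j)) (d + RtoC (INR n))) as HC.
    replace (d + RtoC (INR n) + 1) with (d + RtoC (INR (S n))) in HC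
      by (rewrite S_INR, RtoC_plus; ring).
    replace (1 - a - RtoC (INR j) - 1) with (1 - a - RtoC (INR (S j))) in HC
      by (rewrite S_INR, RtoC_plus; ring).
    transitivity (2 ^ j * (2 * hypreg a (1 - a - RtoC (INR (S j))) (d + RtoC (INR n)))
                  / rGamma (d - a + RtoC (INR n))).
    { rewrite Cpow_S; unfold Cdiv; ring. }
    rewrite <- HC.
    rewrite (rGamma_INR_step (d - a) n) in *.
    assert (H3 : d - a + RtoC (INR n) <> 0).
    { intro E; apply H2; rewrite E; ring. }
    field; auto.
Qed.

(** Both a and d are raised by j, so d - a stays fixed and the same divisor [rGamma (d - a + n)]
    works; the minus sign of the contiguity relation gives q = -1, and (a)_j absorbs its left
    factor. *)
Lemma hypreg_raised (a d : C) (i : nat) : ~ nonpos_int (d - a) ->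
  poch a i * hypreg (a + RtoC (INR i)) (1 - a) (d + RtoC (INR i)) / rGamma (d - a)
  = Cpowr 2 (- a) * sum_n (fun r => RtoC ((-1) ^ r) * RtoC (Binomial.C i r)
      * (rGamma ((d + a + RtoC (INR r)) / 2) / rGamma ((d - a + RtoC (INR r)) / 2))) i.
Proof.
  intro H.
  pose proof (binomial_expansion (-1) (fun j n =>
    poch a j * hypreg (a + RtoC (INR j)) (1 - a) (d + RtoC (INR j) + RtoC (INR n))
    / rGamma (d - a + RtoC (INR n))) i 0) as HX.
  cbv beta in HX; simpl (INR 0) in HX.
  replace (d + RtoC (INR i) + 0) with (d + RtoC (INR i)) in HX by ring.
  replace (d - a + 0) with (d - a) in HX by ring.
  rewrite HX; clear HX.
  - rewrite <- sum_n_scal_C; apply sum_n_ext; intro r.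
    simpl (0 + r)%nat; simpl (poch a 0).
    replace (d + 0) with d by ring; replace (a + 0) with a by ring.
    rewrite RtoC_pow, Cmult_1_l, bailey_quotient by assumption.
    match goal with |- ?x = ?y => change (@eq C x y) end; ring.
  - intros j n.
    pose proof (rGamma_neq_0 _ (not_nonpos_int_plus_INR _ (S n) H)) as H1.
    pose proof (rGamma_neq_0 _ (not_nonpos_int_plus_INR _ n H)) as H2.
    pose proof (hypreg_contiguous_top (a + RtoC (INR (S j))) (1 - a)
      (d + RtoC (INR (S j)) + RtoC (INR n))) as HC.
    replace (a + RtoC (INR (S j)) - 1) with (a + RtoC (INR j)) in HC
      by (rewrite S_INR, RtoC_plus; ring).
    replace (d + RtoC (INR (S j)) + RtoC (INR n) - 1)
      with (d + RtoC (INR j) + RtoC (INR n)) in HC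
      by (rewrite S_INR, RtoC_plus; ring).
    replace (d + RtoC (INR (S j)) + RtoC (INR n) - (a + RtoC (INR (S j))))
      with (d - a + RtoC (INR n)) in HC by ring.
    replace (d + RtoC (INR j) + RtoC (INR (S n)))
      with (d + RtoC (INR (S j)) + RtoC (INR n)) by (rewrite !S_INR, !RtoC_plus; ring).
    change (poch a (S j)) with (poch a j * (a + RtoC (INR j))).
    rewrite <- (Cmult_assoc (poch a j)), HC.
    rewrite (rGamma_INR_step (d - a) n) in *.
    assert (H3 : d - a + RtoC (INR n) <> 0).
    { intro E; apply H2; rewrite E; ring. }
    field; auto.
Qed.

Lemma kdf_sum_hypreg (al ga be d b L : C) :
  b = d - be -> ~ nonpos_int be -> ~ nonpos_int d ->
  kdf_sum [al; ga] [] [b] [be] [] [d] (RtoC (-1)) 1 L ->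
  L = Cpowr 2 (- al) * hypreg al (d - ga) d / rGamma d.
Proof.
  intros Hb Hbe Hd HL.
  pose proof (hyp2F1_at_minus_1 al ga d L Hd (kdf_sum_theta al ga be d b L Hb Hbe Hd HL)) as H.
  set (cf := fun j => poch (d - ga) j / RtoC (INR (fact j)) * (poch al j / poch d j)) in H.
  assert (E : hypreg al (d - ga) d = rGamma d * CPS cf (1 / 2)).
  { unfold hypreg; rewrite <- CPS_scal; [ | | apply Rabs_half_lt_1 ].
    - apply CPS_ext; intro k; unfold hypreg_coef, cf.
      rewrite (rGamma_poch d k).
      field; split; [ apply poch_neq_0, Hd | apply INR_fact_neq_0_C ].
    - apply subexp_mult; [ apply subexp_poch_fact | apply subexp_poch_ratio, Hd ]. }
  pose proof (rGamma_neq_0 d Hd); pose proof (Cpowr_neq_0 2 al).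
  rewrite E, <- H, Cpowr_opp; field; auto.
Qed.

Theorem theorem12 (i : nat) (alpha beta gamma : C) :
  (* first identity *)
  (forall L : C,
     ~ nonpos_int beta ->
     ~ nonpos_int (1 - alpha + gamma + RtoC (INR i)) ->
     ~ nonpos_int (alpha - RtoC (INR i)) ->
     ~ nonpos_int alpha ->
     ~ nonpos_int (1 + gamma - 2 * alpha + RtoC (INR i)) ->
     (forall r : nat, (r <= i)%nat ->
        ~ nonpos_int ((1 + gamma + RtoC (INR i) + RtoC (INR r)) / 2 - alpha) /\
        ~ nonpos_int ((1 + gamma - RtoC (INR i) + RtoC (INR r)) / 2)) ->
     kdf_sum [alpha; gamma] [] [1 - alpha - beta + gamma + RtoC (INR i)]
             [beta] [] [1 - alpha + gamma + RtoC (INR i)]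
             (RtoC (-1)) 1 L ->
     L = Cpowr 2 (RtoC (INR i) - 2 * alpha)
         * CGamma (alpha - RtoC (INR i)) * CGamma (1 - alpha + gamma + RtoC (INR i))
         / (CGamma alpha * CGamma (1 + gamma - 2 * alpha + RtoC (INR i)))
         * sum_n (fun r =>
              RtoC ((-1) ^ r) * RtoC (Binomial.C i r)
              * CGamma ((1 + gamma + RtoC (INR i) + RtoC (INR r)) / 2 - alpha)
              / CGamma ((1 + gamma - RtoC (INR i) + RtoC (INR r)) / 2)) i)
  /\
  (* second identity *)
  (forall L : C,
     ~ nonpos_int beta ->
     ~ nonpos_int (1 - alpha + gamma - RtoC (INR i)) ->
     ~ nonpos_int (1 + gamma - 2 * alpha - RtoC (INR i)) ->
     (forall r : nat, (r <= i)%nat ->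
        ~ nonpos_int ((1 + gamma - RtoC (INR i) + RtoC (INR r)) / 2 - alpha) /\
        ~ nonpos_int ((1 + gamma - RtoC (INR i) + RtoC (INR r)) / 2)) ->
     kdf_sum [alpha; gamma] [] [1 - alpha - beta + gamma - RtoC (INR i)]
             [beta] [] [1 - alpha + gamma - RtoC (INR i)]
             (RtoC (-1)) 1 L ->
     L = Cpowr 2 (- RtoC (INR i) - 2 * alpha)
         * CGamma (1 - alpha + gamma - RtoC (INR i))
         / CGamma (1 + gamma - 2 * alpha - RtoC (INR i))
         * sum_n (fun r =>
              RtoC (Binomial.C i r)
              * CGamma ((1 + gamma - RtoC (INR i) + RtoC (INR r)) / 2 - alpha)
              / CGamma ((1 + gamma - RtoC (INR i) + RtoC (INR r)) / 2)) i).
Proof.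
  pose proof (Cpowr_neq_0 2 alpha) as HP.
  assert (H2i : RtoC 2 ^ i <> 0) by (apply Cpow_nz, RtoC_neq_0; lra).
  split.
  - intros L Hbe Hd Hai Ha Hda Hr HL.
    apply kdf_sum_hypreg in HL; [ | ring | assumption | assumption ].
    (* With this a the parameters are a + i and d - gamma = 1 - a, so Bailey's case sits at (a, 1 -
       a; d - i). The power 2^(-a) combines with Pfaff's 2^(-alpha) to 2^(i - 2 alpha). *)
    set (a := alpha - RtoC (INR i)) in *.
    set (d := 1 - alpha + gamma + RtoC (INR i)) in *.
    assert (E1 : d - RtoC (INR i) - a = 1 + gamma - 2 * alpha + RtoC (INR i))
      by (unfold a, d; ring).
    assert (Hda' : ~ nonpos_int (d - RtoC (INR i) - a)) by (rewrite E1; assumption).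
    pose proof (hypreg_raised a (d - RtoC (INR i)) i Hda') as HR.
    replace (a + RtoC (INR i)) with alpha in HR by (unfold a; ring).
    replace (d - RtoC (INR i) + RtoC (INR i)) with d in HR by ring.
    replace (1 - a) with (d - gamma) in HR by (unfold a, d; ring).
    rewrite E1 in HR.
    (* Once the finite sum is traded for the Gauss series, only powers of 2 and (a)_i = Gamma(alpha)
       / Gamma(alpha - i) remain to be matched. *)
    match goal with |- _ = _ * ?s => replace s with
      (Cpowr 2 a * (poch a i * hypreg alpha (d - gamma) d
         / rGamma (1 + gamma - 2 * alpha + RtoC (INR i)))) end.
    + rewrite HL, !CGamma_rGamma by assumption.
      pose proof (rGamma_neq_0 _ Hd); pose proof (rGamma_neq_0 _ Hda).
      pose proof (rGamma_neq_0 _ Ha); pose proof (poch_neq_0 _ i Hai).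
      rewrite (rGamma_poch a i).
      replace (a + RtoC (INR i)) with alpha by (unfold a; ring).
      replace (Cpowr 2 a) with (Cpowr 2 alpha / Cpowr 2 (RtoC (INR i)))
        by (symmetry; apply Cpowr_minus).
      replace (2 * alpha) with (alpha + alpha) by ring.
      rewrite !Cpowr_minus, Cpowr_plus, Cpowr_opp, Cpowr_INR by lra.
      replace (1 + gamma - (alpha + alpha) + RtoC (INR i))
        with (1 + gamma - 2 * alpha + RtoC (INR i)) by ring.
      field; repeat split; assumption.
    + rewrite HR, Cmult_assoc, Cpowr_opp, Cinv_r, Cmult_1_l by apply Cpowr_neq_0.
      apply sum_n_ext_loc; intros r Hri; destruct (Hr r Hri) as [Hr1 Hr2].
      rewrite !CGamma_rGamma by assumption.
      replace ((d - RtoC (INR i) + a + RtoC (INR r)) / 2)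
        with ((1 + gamma - RtoC (INR i) + RtoC (INR r)) / 2) by (unfold a, d; field).
      replace ((1 + gamma - 2 * alpha + RtoC (INR i) + RtoC (INR r)) / 2)
        with ((1 + gamma + RtoC (INR i) + RtoC (INR r)) / 2 - alpha) by field.
      pose proof (rGamma_neq_0 _ Hr1); pose proof (rGamma_neq_0 _ Hr2).
      match goal with |- ?x = ?y => change (@eq C x y) end; field; auto.
  - intros L Hbe Hd Hda Hr HL.
    apply kdf_sum_hypreg in HL; [ | ring | assumption | assumption ].
    (* Now d - gamma = 1 - alpha - i, so a is alpha itself; the factor 2^i of the lowering chain
       becomes 2^(-i) on the other side. *)
    set (d := 1 - alpha + gamma - RtoC (INR i)) in *.
    assert (E1 : d - alpha = 1 + gamma - 2 * alpha - RtoC (INR i)) by (unfold d; ring).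
    assert (Hda' : ~ nonpos_int (d - alpha)) by (rewrite E1; assumption).
    pose proof (hypreg_lowered alpha d i Hda') as HR.
    replace (1 - alpha - RtoC (INR i)) with (d - gamma) in HR by (unfold d; ring).
    rewrite E1 in HR.
    match goal with |- _ = _ * ?s => replace s with
      (Cpowr 2 alpha * (2 ^ i * hypreg alpha (d - gamma) d
         / rGamma (1 + gamma - 2 * alpha - RtoC (INR i)))) end.
    + rewrite HL, !CGamma_rGamma by assumption.
      pose proof (rGamma_neq_0 _ Hd); pose proof (rGamma_neq_0 _ Hda).
      replace (- RtoC (INR i) - 2 * alpha) with (- RtoC (INR i) - (alpha + alpha)) by ring.
      rewrite Cpowr_minus, Cpowr_plus, !Cpowr_opp, Cpowr_INR by lra.
      field; repeat split; assumption.
    + rewrite HR, Cmult_assoc, Cpowr_opp, Cinv_r, Cmult_1_l by apply Cpowr_neq_0.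
      apply sum_n_ext_loc; intros r Hri; destruct (Hr r Hri) as [Hr1 Hr2].
      rewrite !CGamma_rGamma by assumption.
      replace ((d + alpha + RtoC (INR r)) / 2)
        with ((1 + gamma - RtoC (INR i) + RtoC (INR r)) / 2) by (unfold d; field).
      replace ((1 + gamma - 2 * alpha - RtoC (INR i) + RtoC (INR r)) / 2)
        with ((1 + gamma - RtoC (INR i) + RtoC (INR r)) / 2 - alpha) by field.
      pose proof (rGamma_neq_0 _ Hr1); pose proof (rGamma_neq_0 _ Hr2).
      match goal with |- ?x = ?y => change (@eq C x y) end; field; auto.
Qed.
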